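(* If $A$ is an existentially closed unital $C^*$-algebra, then $K_0(A)=\{0\}$.
   Context: All $C^*$-algebras are unital, and all embeddings and inclusions are unital. We work in continuous logic in the language of unital $C^*$-algebras: a quantifier-free formula $\varphi(x_1,\dots,x_m)$ is an expression $f(\|t_1(x)\|,\dots,\|t_k(x)\|)$ with $f:\mathbb{R}^k\to\mathbb{R}$ continuous and each $t_i$ a $*$-polynomial with complex coefficients (constant terms being multiples of the unit). For $n\ge 1$, $A_{\le n}$ denotes the closed ball of radius $n$ (for tuples, each coordinate has norm at most $n$). If $A\subseteq B$, then $A$ is existentially closed in $B$ if for every quantifier-free formula $\varphi(v,w)$ ($v,w$ finite tuples of variables), every $n\ge1$ and every tuple $a$ from $A$, $\inf\{\varphi(a,b): b\in A_{\le n}\}=\inf\{\varphi(a,c): c\in B_{\le n}\}$. $A$ is existentially closed if it is existentially closed in every $C^*$-algebra $B$ containing $A$ as a unital $C^*$-subalgebra. *)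

(* Defs.v *)
From HB Require Import structures.
From mathcomp Require Import all_boot all_order all_algebra.
From mathcomp Require Import generic_quotient.
From mathcomp Require Import complex.
From mathcomp Require Import all_classical all_reals all_analysis.

Set Implicit Arguments.
Unset Strict Implicit.
Unset Printing Implicit Defensive.

Import Order.TTheory GRing.Theory Num.Theory.
Import numFieldNormedType.Exports.

Local Open Scope classical_set_scope.
Local Open Scope ring_scope.
Local Open Scope quotient_scope.

(** * Unital C*-algebras *)

(* The norm is a new operation, and not the one of a normedModType: Hierarchy
   Builder refuses a structure that joins a ring and a normed module, because
   numDomainType already joins the two. *)
HB.mixin Record isCStarAlgebra (R : realType) A & GRing.Algebra R[i] A := {
  star : A -> A;
  cnorm : A -> R;
  starD : {morph star : a b / a + b};
  starZ : forall (c : R[i]) (a : A), star (c *: a) = conjc c *: star a;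
  starM : forall a b : A, star (a * b) = star b * star a;
  starK : involutive star;
  cnorm_eq0 : forall a : A, cnorm a = 0 -> a = 0;
  cnormZ : forall (c : R[i]) (a : A), cnorm (c *: a) = Normc.normc c * cnorm a;
  ler_cnormD : forall a b : A, cnorm (a + b) <= cnorm a + cnorm b;
  ler_cnormM : forall a b : A, cnorm (a * b) <= cnorm a * cnorm b;
  cnorm_complete : forall u : nat -> A,
    (forall e : R, 0 < e -> exists N : nat, forall i j : nat,
       (N <= i)%N -> (N <= j)%N -> cnorm (u i - u j) < e) ->
    exists l : A, forall e : R, 0 < e -> exists N : nat, forall i : nat,
       (N <= i)%N -> cnorm (u i - l) < e;
  cstar_identity : forall a : A, cnorm (star a * a) = cnorm a ^+ 2
}.

(* As for every algType, 1 != 0: the zero algebra is not included. *)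
#[short(type="cstarAlgType")]
HB.structure Definition CStarAlgebra (R : realType) :=
  {A of GRing.Algebra R[i] A & isCStarAlgebra R A}.

(* The inclusion of A in B as a unital C*-subalgebra, A being identified with
   its image. *)
Record unital_embedding (R : realType) (A B : cstarAlgType R) := UnitalEmbedding {
  emb :> {lrmorphism A -> B};
  emb_star : forall a : A, emb (star a) = star (emb a);
  emb_norm : forall a : A, cnorm (emb a) = cnorm a
}.

(** * Quantifier-free formulas and existential closedness *)

(* The *-polynomials with complex coefficients in the variables x_i, i < m, as
   terms; every notion below depends on their evaluation only. *)
Inductive starpoly (R : realType) (m : nat) : Type :=
| SPvar of 'I_m
| SPconst of R[i]
| SPadd of starpoly R m & starpoly R m
| SPmul of starpoly R m & starpoly R m
| SPstar of starpoly R m.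

Fixpoint sp_eval (R : realType) (A : cstarAlgType R) (m : nat)
    (x : m.-tuple A) (t : starpoly R m) : A :=
  match t with
  | SPvar i => tnth x i
  | SPconst c => c%:A
  | SPadd t1 t2 => sp_eval x t1 + sp_eval x t2
  | SPmul t1 t2 => sp_eval x t1 * sp_eval x t2
  | SPstar t1 => star (sp_eval x t1)
  end.

Record qf_formula (R : realType) (m : nat) : Type := QFFormula {
  qf_arity : nat;
  qf_fun : 'rV[R]_qf_arity -> R;
  qf_continuous : continuous qf_fun;
  qf_term : 'I_qf_arity -> starpoly R m
}.
Arguments qf_fun {R m} _ _.
Arguments qf_term {R m} _ _.

Definition qf_eval (R : realType) (A : cstarAlgType R) (m : nat)
    (phi : qf_formula R m) (x : m.-tuple A) : R :=
  qf_fun phi (\row_i cnorm (sp_eval x (qf_term phi i))).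

Definition tuple_ball (R : realType) (A : cstarAlgType R) (q n : nat) :
    set (q.-tuple A) :=
  [set b | forall i, cnorm (tnth b i) <= n%:R].
Arguments tuple_ball {R} A q n.

(* The infima are taken in \bar R, where they always exist. *)
Definition existentially_closed_in (R : realType) (A B : cstarAlgType R)
    (iota : unital_embedding A B) : Prop :=
  forall (p q : nat) (phi : qf_formula R (p + q)) (n : nat) (a : p.-tuple A),
    (1 <= n)%N ->
    ereal_inf [set (qf_eval phi (cat_tuple a b))%:E | b in tuple_ball A q n] =
    ereal_inf [set (qf_eval phi (cat_tuple (map_tuple iota a) c))%:E
              | c in tuple_ball B q n].

Definition existentially_closed (R : realType) (A : cstarAlgType R) : Prop :=
  forall (B : cstarAlgType R) (iota : unital_embedding A B),
    existentially_closed_in iota.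

(** * The Grothendieck group of a commutative monoid *)

Section Grothendieck.
Variable M : nmodType.

Definition groth_rel (x y : M * M) : bool :=
  `[< exists k : M, x.1 + y.2 + k = y.1 + x.2 + k >].

Lemma groth_refl : reflexive groth_rel.
Proof. by move=> x; apply/asboolP; exists 0. Qed.

Lemma groth_sym : symmetric groth_rel.
Proof. by move=> x y; apply/asboolP/asboolP => -[k e]; exists k. Qed.

Lemma groth_trans : transitive groth_rel.
Proof.
move=> y x z /asboolP[k e] /asboolP[l f]; apply/asboolP.
exists (y.1 + y.2 + k + l).
transitivity ((x.1 + y.2 + k) + (y.1 + z.2 + l)).
  by rewrite !addrA (ACl (1*4*5*3*2*6)).
by rewrite e f !addrA (ACl (4*2*1*5*3*6)).
Qed.

Canonical groth_equiv := EquivRel groth_rel groth_refl groth_sym groth_trans.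

Definition groth := {eq_quot groth_rel}.
HB.instance Definition _ : EqQuotient _ groth_rel groth := EqQuotient.on groth.
HB.instance Definition _ := Choice.on groth.

Definition groth_add := lift_op2 groth (fun x y : M * M => (x.1 + y.1, x.2 + y.2)).
Definition groth_opp := lift_op1 groth (fun x : M * M => (x.2, x.1)).
Definition groth_zero : groth := \pi_groth (0, 0).

Lemma groth_piP (x y : M * M) :
  (exists k, x.1 + y.2 + k = y.1 + x.2 + k) <-> \pi_groth x = \pi_groth y.
Proof.
by split=> [e|/eqmodP/asboolP//]; apply/eqmodP/asboolP.
Qed.

Lemma pi_groth_add :
  {morph \pi_groth : x y / (x.1 + y.1, x.2 + y.2) >-> groth_add x y}.
Proof.
move=> x y; unlock groth_add; apply/groth_piP => /=.
have /groth_piP[k e] : \pi_groth x = \pi_groth (repr (\pi_groth x)) by rewrite reprK.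
have /groth_piP[l f] : \pi_groth y = \pi_groth (repr (\pi_groth y)) by rewrite reprK.
set x' := repr _ in e *; set y' := repr _ in f *.
exists (k + l).
transitivity ((x.1 + x'.2 + k) + (y.1 + y'.2 + l)).
  by rewrite !addrA (ACl (1*3*5*2*4*6)).
by rewrite e f !addrA (ACl (1*4*2*5*3*6)).
Qed.

Lemma pi_groth_opp : {morph \pi_groth : x / (x.2, x.1) >-> groth_opp x}.
Proof.
move=> x; unlock groth_opp; apply/groth_piP => /=.
have /groth_piP[k e] : \pi_groth x = \pi_groth (repr (\pi_groth x)) by rewrite reprK.
by exists k; rewrite (addrC x.2) (addrC _ x.1).
Qed.

Lemma groth_addA : associative groth_add.
Proof.
elim/quotW=> x; elim/quotW=> y; elim/quotW=> z.
by rewrite -!pi_groth_add /= !addrA.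
Qed.

Lemma groth_addC : commutative groth_add.
Proof.
elim/quotW=> x; elim/quotW=> y.
by rewrite -!pi_groth_add /= (addrC x.1) (addrC x.2).
Qed.

Lemma groth_add0 : left_id groth_zero groth_add.
Proof.
by elim/quotW=> -[x y]; rewrite /groth_zero -pi_groth_add /= !add0r.
Qed.

Lemma groth_addN : left_inverse groth_zero groth_opp groth_add.
Proof.
elim/quotW=> x; rewrite -pi_groth_opp -pi_groth_add /groth_zero /=.
by apply/groth_piP; exists 0 => /=; rewrite !addr0 add0r addrC.
Qed.

HB.instance Definition _ :=
  GRing.isZmodule.Build groth groth_addA groth_addC groth_add0 groth_addN.

End Grothendieck.

(** * The semigroup of projections and the K_0 group *)

Section K0.
Variables (R : realType) (A : cstarAlgType R).

Definition mxstar m n (M : 'M[A]_(m, n)) : 'M[A]_(n, m) := (map_mx star M)^T.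

Lemma star0 : star (0 : A) = 0.
Proof. by apply: (addrI (star 0)); rewrite -starD !addr0. Qed.

Lemma star_sum I (r : seq I) (F : I -> A) :
  star (\sum_(i <- r) F i) = \sum_(i <- r) star (F i).
Proof. exact: (big_morph star (@starD R A) star0). Qed.

Lemma mxstarM m n p (M : 'M[A]_(m, n)) (N : 'M[A]_(n, p)) :
  mxstar (M *m N) = mxstar N *m mxstar M.
Proof.
apply/matrixP=> i j; rewrite !mxE star_sum; apply: eq_bigr => k _.
by rewrite !mxE starM.
Qed.

Lemma mxstarK m n (M : 'M[A]_(m, n)) : mxstar (mxstar M) = M.
Proof. by apply/matrixP=> i j; rewrite !mxE starK. Qed.

Lemma mxstar0 m n : mxstar (0 : 'M[A]_(m, n)) = 0.
Proof. by apply/matrixP=> i j; rewrite !mxE star0. Qed.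

Lemma mxstar_block m1 m2 n1 n2 (M : 'M[A]_(m1, n1)) (N : 'M[A]_(m1, n2))
    (P : 'M[A]_(m2, n1)) (Q : 'M[A]_(m2, n2)) :
  mxstar (block_mx M N P Q) =
  block_mx (mxstar M) (mxstar P) (mxstar N) (mxstar Q).
Proof. by rewrite /mxstar map_block_mx tr_block_mx. Qed.

(* The projections in matrix algebras over A of all sizes. The only projection
   of size 0 is equivalent to the zero projection of any size. *)
Record projection := Projection {
  prsize : nat;
  prmx :> 'M[A]_prsize;
  pr_idem : prmx *m prmx = prmx;
  pr_star : mxstar prmx = prmx
}.

HB.instance Definition _ := gen_eqMixin projection.
HB.instance Definition _ := gen_choiceMixin projection.

Definition mvn (p q : projection) : bool :=
  `[< exists v : 'M[A]_(prsize q, prsize p),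
        mxstar v *m v = p /\ v *m mxstar v = q >].

Lemma mvn_refl : reflexive mvn.
Proof. by move=> p; apply/asboolP; exists p; rewrite pr_star pr_idem. Qed.

Lemma mvn_sym : symmetric mvn.
Proof.
by move=> p q; apply/asboolP/asboolP => -[v [v1 v2]];
  exists (mxstar v); rewrite mxstarK.
Qed.

Lemma mvn_trans : transitive mvn.
Proof.
move=> q p r /asboolP[v [vp vq]] /asboolP[w [wq wr]]; apply/asboolP.
exists (w *m v); rewrite mxstarM; split.
  by rewrite mulmxA -(mulmxA _ _ w) wq -vq mulmxA vp -mulmxA vp pr_idem.
by rewrite mulmxA -(mulmxA w) vq -wq mulmxA wr -mulmxA wr pr_idem.
Qed.

Canonical mvn_equiv := EquivRel mvn mvn_refl mvn_sym mvn_trans.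

Definition prclass := {eq_quot mvn}.
HB.instance Definition _ : EqQuotient _ mvn prclass := EqQuotient.on prclass.
HB.instance Definition _ := Choice.on prclass.

Definition dsum_mx m n (M : 'M[A]_m) (N : 'M[A]_n) : 'M[A]_(m + n) :=
  block_mx M 0 0 N.

Lemma pr_dsum_idem (p q : projection) :
  dsum_mx p q *m dsum_mx p q = dsum_mx p q.
Proof.
by rewrite mulmx_block !(mul0mx, mulmx0, addr0, add0r) !pr_idem.
Qed.

Lemma pr_dsum_star (p q : projection) : mxstar (dsum_mx p q) = dsum_mx p q.
Proof. by rewrite mxstar_block !pr_star !mxstar0. Qed.

Definition pr_dsum (p q : projection) : projection :=
  Projection (pr_dsum_idem p q) (pr_dsum_star p q).

Lemma pr_zero_idem : (0 : 'M[A]_0) *m (0 : 'M[A]_0) = 0.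
Proof. exact: mulmx0. Qed.

Definition pr_zero : projection := Projection pr_zero_idem (mxstar0 0 0).

Definition prclass_add := lift_op2 prclass pr_dsum.
Definition prclass_zero : prclass := \pi_prclass pr_zero.

Lemma prclassP (p q : projection) :
  (exists v : 'M[A]_(prsize q, prsize p),
     mxstar v *m v = p /\ v *m mxstar v = q)
  <-> \pi_prclass p = \pi_prclass q.
Proof.
by split=> [e|/eqmodP/asboolP//]; apply/eqmodP/asboolP.
Qed.

Lemma pi_prclass_add : {morph \pi_prclass : p q / pr_dsum p q >-> prclass_add p q}.
Proof.
move=> p q; unlock prclass_add; apply/prclassP => /=.
have /prclassP[v [v1 v2]] : \pi_prclass p = \pi_prclass (repr (\pi_prclass p)) by rewrite reprK.
have /prclassP[w [w1 w2]] : \pi_prclass q = \pi_prclass (repr (\pi_prclass q)) by rewrite reprK.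
exists (block_mx v 0 0 w).
by rewrite mxstar_block !mxstar0 !mulmx_block
  !(mul0mx, mulmx0, addr0, add0r) v1 v2 w1 w2.
Qed.

Lemma mvn_castmx (p q : projection) (e : prsize q = prsize p) :
  prmx p = castmx (e, e) (prmx q) -> \pi_prclass p = \pi_prclass q.
Proof.
case: p q e => [m p p1 p2] [n q q1 q2] /= e; case: m / e p p1 p2 => p p1 p2.
rewrite castmx_id => pq; apply/prclassP => /=; exists p.
by rewrite p2 p1 -pq.
Qed.

Lemma prclass_addA : associative prclass_add.
Proof.
elim/quotW=> p; elim/quotW=> q; elim/quotW=> r; rewrite -!pi_prclass_add.
apply: (@mvn_castmx (pr_dsum p (pr_dsum q r)) (pr_dsum (pr_dsum p q) r)
  (esym (addnA _ _ _))) => /=.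
rewrite /dsum_mx -row_mx0 -col_mx0 block_mxA.
by rewrite row_mx0 col_mx0.
Qed.

Lemma prclass_addC : commutative prclass_add.
Proof.
elim/quotW=> p; elim/quotW=> q; rewrite -!pi_prclass_add; apply/prclassP => /=.
exists (block_mx 0 q p 0).
by rewrite mxstar_block !mxstar0 !mulmx_block
  !(mul0mx, mulmx0, addr0, add0r) !pr_star !pr_idem.
Qed.

Lemma prclass_add0 : left_id prclass_zero prclass_add.
Proof.
elim/quotW=> p; rewrite /prclass_zero -pi_prclass_add; apply/prclassP => /=.
exists (row_mx 0 p).
have -> : mxstar (row_mx (0 : 'M[A]_(prsize p, 0)) p) = col_mx 0 p.
  by rewrite /mxstar map_row_mx tr_row_mx -/(mxstar _) mxstar0 -/(mxstar _) pr_star.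
by rewrite mul_col_row mul_row_col !(mul0mx, mulmx0, add0r) pr_idem.
Qed.

HB.instance Definition _ :=
  GRing.isNmodule.Build prclass prclass_addA prclass_addC prclass_add0.

(* As A is unital, this is K_0(A), with no need for the kernel of the map from
   the unitization to the scalars. *)
Definition K0 := groth prclass.
HB.instance Definition _ := GRing.Zmodule.on K0.

End K0.

(* Main.v *)
(* If two isometries s_0, s_1 satisfy the Cuntz relations s_i^* s_j = delta_ij
   and s_0 s_0^* + s_1 s_1^* = 1 and commute with the entries of a projection p,
   then the column of the s_i^* p is a partial isometry from p to p (+) p, so
   that [p] = 2 [p] = 0.  Such isometries exist in a C*-algebra containing A:
   on the Hilbert A-module l^2(A) they are given by n |-> 2n and n |-> 2n + 1, and
   they commute with the diagonal action of A.  By existential closedness A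
   contains approximate ones, and Newton's iteration for the polar decomposition
   turns the resulting approximate equivalence of p and p (+) p into an exact
   one.  That l^2(A) is a Hilbert module rests on the theorem that x^* x is a
   square of a self-adjoint element. *)

Require Import Defs.
From HB Require Import structures.
From mathcomp Require Import all_boot all_order all_algebra.
From mathcomp Require Import complex lra.
From mathcomp Require Import all_classical all_reals all_analysis.

Set Implicit Arguments.
Unset Strict Implicit.
Unset Printing Implicit Defensive.

Import Order.TTheory GRing.Theory Num.Theory.
Import numFieldNormedType.Exports.

Local Open Scope classical_set_scope.
Local Open Scope ring_scope.

(** No spectrum or functional calculus is at hand. Positive means being the square of a self-adjoint
    element, and everything about positivity is drawn from one iteration for the square root, whose
    limit commutes with whatever commutes with the data. The $A$-valued inner product, its
    Cauchy-Schwarz inequality and the boundedness of the left action rest on this order.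

    A formula speaks of elements of [A], hence of single entries of $p$, and it yields relations up
    to any $e>0$, never exact ones. Matrices therefore carry the sum of the norms of their entries,
    and $e$ is chosen small against the size and the norm of $p$. This norm is complete and
    submultiplicative, which is what Newton's step uses. The step keeps $w$ in the corner between
    $p$ and $q$ and commutes with the adjoint, so that $p-w^*w$ and $q-ww^*$ shrink together. *)

Local Notation "t *# a" := ((t%:C)%C *: a) (at level 40).

(** * Elementary properties of the norm and the involution *)

Section CStarBasics.
Variables (R : realType) (A : cstarAlgType R).
Implicit Types (a b h k x y z : A) (t : R).

Lemma normc_real t : Normc.normc (t%:C)%C = `|t|.
Proof. by rewrite /= expr0n /= addr0 sqrtr_sqr. Qed.

Lemma cnormR t a : cnorm (t *# a) = `|t| * cnorm a.
Proof. by rewrite cnormZ normc_real. Qed.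

Lemma cnorm0 : cnorm (0 : A) = 0.
Proof. by rewrite -(scale0r (0 : A)) (cnormR 0) normr0 mul0r. Qed.

Lemma cnormN a : cnorm (- a) = cnorm a.
Proof. by rewrite -scaleN1r -[- 1](rmorphN1 (real_complex R)) cnormR normrN1 mul1r. Qed.

Lemma cnorm_ge0 a : 0 <= cnorm a.
Proof.
have := ler_cnormD a (- a); rewrite subrr cnorm0 cnormN; lra.
Qed.

Lemma ler_cnormB a b : cnorm (a - b) <= cnorm a + cnorm b.
Proof. by rewrite -(cnormN b); apply: ler_cnormD. Qed.

Lemma cnorm_distC a b : cnorm (a - b) = cnorm (b - a).
Proof. by rewrite -cnormN opprB. Qed.

Lemma ler_cnorm_dist b a c : cnorm (a - c) <= cnorm (a - b) + cnorm (b - c).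
Proof. by rewrite -{1}(subrK b a) -addrA; apply: ler_cnormD. Qed.

Lemma starN a : star (- a) = - star a.
Proof. by apply: (addIr (star a)); rewrite -starD !addNr star0. Qed.

Lemma starB a b : star (a - b) = star a - star b.
Proof. by rewrite starD starN. Qed.

Lemma star1 : star (1 : A) = 1.
Proof. by rewrite -[LHS]mulr1 -{2}(starK 1) -starM mulr1 starK. Qed.

Lemma starR t a : star (t *# a) = t *# star a.
Proof. by rewrite starZ conjc_real. Qed.

(** The involution is not assumed isometric: the C*-identity gives $\|b\|^2\le\|b^*\|\|b\|$, and the
    same for $b^*$ gives the other inequality. *)
Lemma cnorm_star a : cnorm (star a) = cnorm a.
Proof.
suff H b : cnorm b <= cnorm (star b) by apply/eqP; rewrite eq_le H -{2}(starK a) H.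
have := cnorm_ge0 b; rewrite le_eqVlt => /orP[/eqP <-|b0]; first exact: cnorm_ge0.
by rewrite -(ler_pM2r b0) -expr2 -cstar_identity ler_cnormM.
Qed.

Lemma cnorm_sqr a : star a = a -> cnorm (a * a) = cnorm a ^+ 2.
Proof. by move=> aa; rewrite -{1}aa cstar_identity. Qed.

Lemma cnorm1 : cnorm (1 : A) = 1.
Proof.
have := cstar_identity (1 : A); rewrite star1 mulr1 => h.
have : cnorm (1 : A) != 0 by apply/eqP => /cnorm_eq0/eqP; rewrite oner_eq0.
by move=> n0; apply: (mulfI n0); rewrite -expr2 -h mulr1.
Qed.

Lemma rscaleA t u a : t *# (u *# a) = (t * u) *# a.
Proof. by rewrite scalerA -rmorphM. Qed.

Lemma cnorm_scalar t : 0 <= t -> cnorm (t *# (1 : A)) = t.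
Proof. by move=> t0; rewrite cnormR cnorm1 mulr1 ger0_norm. Qed.

Lemma ler_cnorm_sum I (r : seq I) (P : pred I) (F : I -> A) :
  cnorm (\sum_(i <- r | P i) F i) <= \sum_(i <- r | P i) cnorm (F i).
Proof.
elim/big_ind2: _ => [|a s b t|//]; first by rewrite cnorm0.
by move=> ha hb; apply: le_trans (ler_cnormD _ _) _; apply: lerD.
Qed.

End CStarBasics.

(** * Convergent sequences in a C*-algebra *)

Section Convergence.
Variables (R : realType) (A : cstarAlgType R).
Implicit Types (a b : A) (u v : nat -> A).

(** [cstarAlgType] carries no topology, so convergence is spelled out in the shape of
    [cnorm_complete]. *)
Definition cvg_cnorm u a : Prop :=
  forall e : R, 0 < e -> exists N : nat, forall n, (N <= n)%N -> cnorm (u n - a) < e.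

Lemma cnorm_le_eps a (t : R) : (forall e : R, 0 < e -> cnorm a <= t + e) -> cnorm a <= t.
Proof. by move=> h; apply/ler_addgt0Pr. Qed.

Lemma cvg_cnorm_unique u a b : cvg_cnorm u a -> cvg_cnorm u b -> a = b.
Proof.
move=> ua ub; apply/eqP; rewrite -subr_eq0; apply/eqP/cnorm_eq0/eqP.
rewrite eq_le cnorm_ge0 andbT; apply: cnorm_le_eps => e e0.
have [N hN] := ua (e / 2) (divr_gt0 e0 (ltr0n _ 2)).
have [M hM] := ub (e / 2) (divr_gt0 e0 (ltr0n _ 2)).
have := hN _ (leq_maxl N M); have := hM _ (leq_maxr N M).
have := ler_cnorm_dist (u (maxn N M)) a b; rewrite (cnorm_distC a (u _)); lra.
Qed.

Lemma cvg_cnorm_cst a : cvg_cnorm (fun=> a) a.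
Proof. by move=> e e0; exists 0%N => n _; rewrite subrr cnorm0. Qed.

Lemma cvg_cnormD u v a b :
  cvg_cnorm u a -> cvg_cnorm v b -> cvg_cnorm (fun n => u n + v n) (a + b).
Proof.
move=> ua ub e e0.
have [N hN] := ua (e / 2) (divr_gt0 e0 (ltr0n _ 2)).
have [M hM] := ub (e / 2) (divr_gt0 e0 (ltr0n _ 2)).
exists (maxn N M) => n; rewrite geq_max => /andP[/hN {}hN /hM {}hM].
rewrite opprD addrACA; apply: le_lt_trans (ler_cnormD _ _) _; lra.
Qed.

(** The common source of continuity for the operations in one variable. In the proof [|C| + 1]
    replaces [C] as a positive divisor. *)
Lemma cvg_cnorm_lip u v a b (C : R) :
  (forall n, cnorm (v n - b) <= C * cnorm (u n - a)) ->
  cvg_cnorm u a -> cvg_cnorm v b.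
Proof.
move=> vu ua e e0.
have C0 : 0 < `|C| + 1 by rewrite ltr_wpDl.
have [N hN] := ua (e / (`|C| + 1)) (divr_gt0 e0 C0).
exists N => n /hN; rewrite ltr_pdivlMr // => h.
apply: le_lt_trans (vu n) _; apply: le_lt_trans h.
rewrite mulrC ler_wpM2l ?cnorm_ge0 //; have := ler_norm C; lra.
Qed.

Lemma cvg_cnorm_star u a : cvg_cnorm u a -> cvg_cnorm (fun n => star (u n)) (star a).
Proof. by apply: (@cvg_cnorm_lip _ _ _ _ 1) => n; rewrite mul1r -starB cnorm_star. Qed.

Lemma cvg_cnormMl u a b : cvg_cnorm u a -> cvg_cnorm (fun n => b * u n) (b * a).
Proof. by apply: (@cvg_cnorm_lip _ _ _ _ (cnorm b)) => n; rewrite -mulrBr ler_cnormM. Qed.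

Lemma cvg_cnormMr u a b : cvg_cnorm u a -> cvg_cnorm (fun n => u n * b) (a * b).
Proof.
by apply: (@cvg_cnorm_lip _ _ _ _ (cnorm b)) => n; rewrite -mulrBl mulrC ler_cnormM.
Qed.

Lemma cvg_cnormZ u a c : cvg_cnorm u a -> cvg_cnorm (fun n => c *: u n) (c *: a).
Proof.
by apply: (@cvg_cnorm_lip _ _ _ _ (Normc.normc c)) => n; rewrite -scalerBr cnormZ.
Qed.

Lemma cvg_cnorm_shift u a m : cvg_cnorm u a -> cvg_cnorm (fun n => u (m + n)%N) a.
Proof.
move=> ua e /ua[N hN]; exists N => n Nn; apply: hN.
exact: leq_trans Nn (leq_addl _ _).
Qed.

Lemma cvg_cnorm_le u a (t : R) N :
  cvg_cnorm u a -> (forall n, (N <= n)%N -> cnorm (u n) <= t) -> cnorm a <= t.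
Proof.
move=> ua ut; apply: cnorm_le_eps => e /ua[M hM].
have := hM _ (leq_maxr N M); have := ut _ (leq_maxl N M).
rewrite cnorm_distC => h1 h2.
by rewrite -(subrK (u (maxn N M)) a) addrC; apply: le_trans (ler_cnormD _ _) _; lra.
Qed.

Lemma cvg_cnormM u v a b (t : R) :
  (forall n, cnorm (u n) <= t) -> cvg_cnorm u a -> cvg_cnorm v b ->
  cvg_cnorm (fun n => u n * v n) (a * b).
Proof.
move=> ut ua vb; have : cvg_cnorm (fun n => u n * (v n - b) + u n * b) (0 + a * b).
  apply: cvg_cnormD; last exact: cvg_cnormMr.
  apply: (@cvg_cnorm_lip v _ b _ t) vb => n; rewrite subr0.
  by apply: le_trans (ler_cnormM _ _) _; apply: ler_wpM2r; rewrite ?cnorm_ge0.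
rewrite add0r => h e /h[N hN]; exists N => n /hN.
by rewrite mulrBr subrK.
Qed.

(* The hypothesis compares u with a real sequence r that is increasing and
   bounded, which makes u a Cauchy sequence without any summation. *)
Lemma cvg_cnorm_dominated u (r : nat -> R) (M : R) :
  (forall n, r n <= M) -> (forall n, cnorm (u n.+1 - u n) <= r n.+1 - r n) ->
  exists a, cvg_cnorm u a.
Proof.
move=> rM ur; apply: cnorm_complete => e e0.
have urmn m n : (m <= n)%N -> cnorm (u n - u m) <= r n - r m.
  elim: n => [|n IH]; first by rewrite leqn0 => /eqP->; rewrite !subrr cnorm0.
  rewrite leq_eqVlt => /orP[/eqP->|]; first by rewrite !subrr cnorm0.
  rewrite ltnS => /IH h; have := ur n; have := ler_cnorm_dist (u n) (u n.+1) (u m); lra.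
have rS : has_sup (range r).
  by split; [exists (r 0%N), 0%N|exists M => _ [n _ <-]].
have [_ [N _ <-] rN] := sup_adherent (divr_gt0 e0 (ltr0n _ 2)) rS.
exists N => i j Ni Nj.
have hi := urmn _ _ Ni; have hj := urmn _ _ Nj.
have ri : r i <= sup (range r) by apply: ub_le_sup; [case: rS|exists i].
have rj : r j <= sup (range r) by apply: ub_le_sup; [case: rS|exists j].
have := ler_cnorm_dist (u N) (u i) (u j); rewrite (cnorm_distC (u N)); lra.
Qed.

End Convergence.

(** * Square roots by iteration *)

Section Positivity.
Variables (R : realType) (A : cstarAlgType R).
Implicit Types (a b c d h k r s x y z : A) (t : R).

Lemma rscaleD t u a : t *# a + u *# a = (t + u) *# a.
Proof. by rewrite -scalerDl -rmorphD. Qed.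

Lemma rscale_half a : 2^-1 *# (a + a) = a.
Proof. by rewrite scalerDr rscaleD [_ + _](_ : _ = 1) ?scale1r //; lra. Qed.

(** A fixed point $y=(x+y^2)/2$ satisfies $(1-y)^2=1-x$: the iteration computes $1-\sqrt{1-x}$. *)
Fixpoint sqrt_iter x n : A :=
  if n is n'.+1 then 2^-1 *# (x + sqrt_iter x n' * sqrt_iter x n') else 0.

(** The same iteration at the number $1$. It dominates all the others with $\|x\|\le1$, since the
    iterates are polynomials with nonnegative coefficients. *)
Fixpoint sqrt_iter_bound n : R :=
  if n is n'.+1 then 2^-1 * (1 + sqrt_iter_bound n' * sqrt_iter_bound n') else 0.

Lemma sqrt_iter_bound_ge0_le1 n : 0 <= sqrt_iter_bound n <= 1.
Proof. by elim: n => [|n /andP[h0 h1]] /=; rewrite ?lexx ?ler01 //; apply/andP; split; nra. Qed.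

Lemma cnorm_sqrt_iter x n : cnorm x <= 1 -> cnorm (sqrt_iter x n) <= sqrt_iter_bound n.
Proof.
move=> x1; elim: n => [|n IH] /=; first by rewrite cnorm0.
rewrite cnormR ger0_norm ?invr_ge0 // ler_wpM2l ?invr_ge0 //.
apply: le_trans (ler_cnormD _ _) _; apply: lerD => //.
apply: le_trans (ler_cnormM _ _) _.
by apply: ler_pM => //; apply: cnorm_ge0.
Qed.

(** The identity $y^2-z^2=y(y-z)+(y-z)z$ gives the increments a recursion that the scalar majorant
    satisfies with equality, so induction compares the two. *)
Lemma cnorm_sqrt_iterS x n : cnorm x <= 1 ->
  cnorm (sqrt_iter x n.+1 - sqrt_iter x n) <= sqrt_iter_bound n.+1 - sqrt_iter_bound n.
Proof.
move=> x1; elim: n => [|n IH].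
  rewrite /= !(mulr0, addr0, subr0) mulr1 cnormR ger0_norm ?invr_ge0 //.
  by have := cnorm_ge0 x; lra.
set y := sqrt_iter x n.+1 in IH *; set z := sqrt_iter x n in IH *.
have -> : sqrt_iter x n.+2 - y = 2^-1 *# (y * (y - z) + (y - z) * z).
  rewrite -[sqrt_iter x n.+2]/(2^-1 *# (x + y * y)) {2}/y.
  rewrite -[sqrt_iter x n.+1]/(2^-1 *# (x + z * z)) -scalerBr; congr (_ *: _).
  by rewrite opprD addrACA subrr add0r mulrBr mulrBl addrA subrK.
have yn := cnorm_sqrt_iter n.+1 x1; have zn := cnorm_sqrt_iter n x1.
rewrite cnormR ger0_norm ?invr_ge0 //.
set p := sqrt_iter_bound n.+1 in yn IH *; set q := sqrt_iter_bound n in zn IH *.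
rewrite -[sqrt_iter_bound n.+2]/(2^-1 * (1 + p * p)).
have pE : p = 2^-1 * (1 + q * q) by [].
have h1 := ler_pM (cnorm_ge0 y) (cnorm_ge0 (y - z)) yn IH.
have h2 := ler_pM (cnorm_ge0 (y - z)) (cnorm_ge0 z) IH zn.
have := ler_cnormD (y * (y - z)) ((y - z) * z).
have := ler_cnormM y (y - z); have := ler_cnormM (y - z) z.
lra.
Qed.

Lemma sqrt_iter_limit x : cnorm x <= 1 ->
  exists y, [/\ cnorm y <= 1, y + y = x + y * y,
    forall z, z * x = x * z -> z * y = y * z & star x = x -> star y = y].
Proof.
move=> x1.
have yle n : cnorm (sqrt_iter x n) <= 1.
  by apply: le_trans (cnorm_sqrt_iter n x1) _; case/andP: (sqrt_iter_bound_ge0_le1 n).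
have [||y xy] := @cvg_cnorm_dominated _ _ (sqrt_iter x) sqrt_iter_bound 1.
- by move=> n; case/andP: (sqrt_iter_bound_ge0_le1 n).
- by move=> n; apply: cnorm_sqrt_iterS.
exists y; split.
- exact: (cvg_cnorm_le xy (N := 0%N)).
- have h : y = 2^-1 *# (x + y * y).
    apply: (cvg_cnorm_unique (cvg_cnorm_shift 1 xy)).
    apply: cvg_cnormZ; apply: cvg_cnormD; first exact: cvg_cnorm_cst.
    exact: (cvg_cnormM yle xy xy).
  by rewrite {1 2}h -scalerDr -[RHS]rscale_half.
- move=> z zx; apply: (cvg_cnorm_unique (cvg_cnormMl z xy)).
  have -> : (fun n => z * sqrt_iter x n) = (fun n => sqrt_iter x n * z).
    apply: boolp.funext; elim=> [|n IH] /=; first by rewrite mulr0 mul0r.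
    rewrite -scalerAr -scalerAl mulrDr mulrDl zx; congr (_ *: (_ + _)).
    by rewrite mulrA IH -mulrA IH mulrA.
  exact: cvg_cnormMr.
- move=> xx; apply: (cvg_cnorm_unique (cvg_cnorm_star xy)).
  have -> : (fun n => star (sqrt_iter x n)) = sqrt_iter x.
    apply: boolp.funext; elim=> [|n IH] /=; first by rewrite star0.
    by rewrite starR starD starM IH xx.
  by [].
Qed.

(** For $t>0$ the element $x=1-h/t$ has norm at most $1$, and the root is $\sqrt t\,(1-y)$ with $y$
    the limit of the iteration at $x$. The distance bound on [s] has the form of the hypothesis on
    [h], so that roots can be taken repeatedly; the last clause does the work of functional
    calculus. *)
Lemma sqrt_near_scalar h t : star h = h -> cnorm (t *# 1 - h) <= t ->
  exists s, [/\ star s = s, s * s = h, cnorm (Num.sqrt t *# 1 - s) <= Num.sqrt t &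
    forall z, z * h = h * z -> z * s = s * z].
Proof.
move=> hh ht; have t0 : 0 <= t by apply: le_trans ht; apply: cnorm_ge0.
move: (t0); rewrite le_eqVlt => /orP[/eqP t00|tp].
  have -> : h = 0.
    apply: cnorm_eq0; apply/eqP; rewrite eq_le cnorm_ge0 andbT -cnormN.
    by move: ht; rewrite -t00 scale0r sub0r.
  by exists 0; rewrite star0 mulr0 subr0 cnorm_scalar ?sqrtr_ge0 //; split=> // z _;
    rewrite mulr0 mul0r.
pose x := 1 - t^-1 *# h.
have xx : star x = x by rewrite starB star1 starR hh.
have x1 : cnorm x <= 1.
  have -> : x = t^-1 *# (t *# 1 - h).
    by rewrite scalerBr rscaleA mulVf ?gt_eqF // scale1r.
  rewrite cnormR ger0_norm ?invr_ge0 // -(mulVf (lt0r_neq0 tp)).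
  by rewrite ler_wpM2l ?invr_ge0.
have [y [y1 yE yc ys]] := sqrt_iter_limit x1.
exists (Num.sqrt t *# (1 - y)); split.
- by rewrite starR starB star1 ys.
- rewrite -scalerAl -scalerAr rscaleA -expr2 sqr_sqrtr //.
  rewrite mulrBl mul1r mulrBr mulr1 opprB addrACA -opprD yE opprD addrACA subrr addr0.
  by rewrite /x opprB addrC subrK rscaleA divff ?gt_eqF // scale1r.
- rewrite -scalerBr opprB addrC subrK cnormR ger0_norm ?sqrtr_ge0 //.
  by rewrite ler_piMr ?sqrtr_ge0.
- move=> z zh; rewrite -scalerAr -scalerAl mulrBr mulrBl mulr1 mul1r yc //.
  by rewrite /x mulrBr mulrBl mulr1 mul1r -scalerAr -scalerAl zh.
Qed.

(* As k and s commute, k + is is a multiple of a unitary. *)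
Lemma cnorm_le_of_sum_squares k s t : 0 <= t -> star k = k -> star s = s ->
  k * s = s * k -> k * k + s * s = t *# 1 -> cnorm k ^+ 2 <= t.
Proof.
move=> t0 kk ss ks kst.
pose i : R[i] := Complex 0 1; pose u := k + i *: s.
have us : star u = k - i *: s.
  rewrite starD starZ kk ss /= -[Complex 0 (-1)](_ : - i = _) ?scaleNr //.
  by apply/eqP; rewrite eq_complex /= oppr0 !eqxx.
have uu : cnorm u ^+ 2 = t.
  rewrite -cstar_identity us mulrDr !mulrBl -!scalerAl -!scalerAr scalerA ks.
  rewrite [i * i](sqr_i R) scaleN1r opprK.
  by rewrite addrA subrK kst cnorm_scalar.
have ku : k = 2^-1 *# (u + star u) by rewrite us addrACA subrr addr0 rscale_half.
rewrite -uu lerXn2r ?nnegrE ?cnorm_ge0 // ku cnormR ger0_norm ?invr_ge0 //.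
have := ler_cnormD u (star u); rewrite cnorm_star; lra.
Qed.
End Positivity.

(** * The positive cone *)

Section PositiveElements.
Variables (R : realType) (A : cstarAlgType R).
Implicit Types (a b c d h k r s x y z : A) (t : R).

(** With this definition closure under sums comes from the norm criterion in [cpos_of_norm] and
    [cpos_norm], and closure under conjugation from [cpos_starM]. *)
Definition cpos h : Prop := exists k, star k = k /\ h = k * k.

Lemma cpos_star h : cpos h -> star h = h.
Proof. by case=> k [kk ->]; rewrite starM kk. Qed.

Lemma cpos_sqr k : star k = k -> cpos (k * k).
Proof. by exists k. Qed.

Lemma cpos_of_norm h t : star h = h -> cnorm (t *# 1 - h) <= t -> cpos h.
Proof. by move=> hh /(sqrt_near_scalar hh)[s [ss <- _ _]]; exists s. Qed.

(** Writing $h=k^2$, the element $t-k^2$ is within $t$ of $t$, so it has a root $s$ that commutes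
    with $k$; then $k^2+s^2=t$ bounds $\|s\|^2=\|t-h\|$. *)
Lemma cpos_norm h t : cpos h -> cnorm h <= t -> cnorm (t *# 1 - h) <= t.
Proof.
case=> k [kk ->]; rewrite cnorm_sqr // => kt.
have t0 : 0 <= t by apply: le_trans kt; rewrite sqr_ge0.
have hs : star (t *# 1 - k * k) = t *# 1 - k * k.
  by rewrite starB starR star1 starM kk.
have [|s [ss sE _ sc]] := @sqrt_near_scalar _ _ _ t hs.
  by rewrite opprB addrC subrK cnorm_sqr.
rewrite -sE cnorm_sqr //; apply: (cnorm_le_of_sum_squares (s := k)) => //.
  apply/esym/sc; rewrite mulrBr mulrBl mulrA.
  by rewrite -scalerAl -scalerAr mul1r mulr1.
by rewrite sE subrK.
Qed.

Lemma cposD a b : cpos a -> cpos b -> cpos (a + b).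
Proof.
move=> pa pb; apply: (@cpos_of_norm _ (cnorm a + cnorm b)).
  by rewrite starD !cpos_star.
rewrite -rscaleD opprD addrACA; apply: le_trans (ler_cnormD _ _) _.
by apply: lerD; apply: cpos_norm.
Qed.

Lemma cpos0 : cpos 0.
Proof. by exists 0; rewrite star0 mulr0. Qed.

Lemma cposZ t a : 0 <= t -> cpos a -> cpos (t *# a).
Proof.
move=> t0 [k [kk ->]]; exists (Num.sqrt t *# k); rewrite starR kk; split=> //.
by rewrite -scalerAl -scalerAr rscaleA -(expr2 (Num.sqrt t)) sqr_sqrtr.
Qed.

Lemma cpos_sum I (r : seq I) (P : pred I) (F : I -> A) :
  (forall i, P i -> cpos (F i)) -> cpos (\sum_(i <- r | P i) F i).
Proof. by move=> h; apply: big_ind => //; [exact: cpos0|exact: cposD]. Qed.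

Lemma cpos_scalarB a t : star a = a -> cnorm a <= t -> cpos (t *# 1 - a).
Proof.
move=> aa at_; apply: (@cpos_of_norm _ t); first by rewrite starB starR star1 aa.
by rewrite opprB addrC subrK.
Qed.

(** With $t=\|d\|$ and $c=k^2$, the element $t-c=(t-d)+(d-c)$ is positive. Passing it through
    [sqrt_near_scalar] gives a root $s$ that commutes with $k$, which [cpos] alone does not provide,
    and $k^2+s^2=t$ bounds $\|k\|^2$. *)
Lemma cpos_norm_le c d : cpos c -> cpos (d - c) -> cnorm c <= cnorm d.
Proof.
move=> pc pdc; set t := cnorm d; have t0 : 0 <= t by apply: cnorm_ge0.
have pd : cpos d by rewrite -(subrK c d); apply: cposD.
have : cpos (t *# 1 - c).
  rewrite -(subrK d (t *# 1)) -addrA; apply: cposD => //.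
  by apply: cpos_scalarB => //; apply: cpos_star.
move=> pe; have es := cpos_star pe.
have [s [ss sE _ sc]] := sqrt_near_scalar es (cpos_norm pe (lexx _)).
case: pc sE sc => k [kk ->] sE sc; rewrite cnorm_sqr //.
apply: (cnorm_le_of_sum_squares (s := s)) => //; last by rewrite sE addrC subrK.
by apply: sc; rewrite mulrBr mulrBl mulrA -scalerAl -scalerAr mul1r mulr1.
Qed.

(** For $y=u+iv$ the cross terms of $y^*y$ and $yy^*$ cancel. This turns a negative $y^*y$ into a
    positive $yy^*$. *)
Lemma re_im_decomp y : exists u v : A,
  [/\ star u = u, star v = v & star y * y + y * star y = (u * u + v * v) + (u * u + v * v)].
Proof.
pose i : R[i] := Complex 0 1.
have ii : i * i = -1 := sqr_i R.
have istar a : star (i *: a) = - (i *: star a).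
  rewrite starZ -scaleNr; congr (_ *: _).
  by apply/eqP; rewrite eq_complex /= oppr0 !eqxx.
pose u := 2^-1 *# (y + star y); pose v := 2^-1 *# (i *: (star y - y)).
exists u, v.
have us : star u = u by rewrite starR starD starK addrC.
have vs : star v = v by rewrite starR istar starB starK -scalerN opprB.
have yE : y = u + i *: v.
  rewrite /v [i *: _](_ : _ = 2^-1 *# (y - star y)); last first.
    by rewrite scalerA mulrC -scalerA; congr (_ *: _); rewrite scalerA ii scaleN1r opprB.
  by rewrite -scalerDr addrACA subrr addr0 rscale_half.
have ysE : star y = u - i *: v by rewrite yE starD istar us vs.
clearbody u v; split=> //; rewrite ysE yE.
rewrite !mulrDr !mulrDl !mulNr !mulrN -!scalerAl -!scalerAr.
rewrite scalerA ii scaleN1r opprK.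
have E (p q c d : A) : p - c + (d + q) + (p + c + (- d + q)) = p + q + (p + q).
  rewrite [d + q]addrC [- d + q]addrC ![_ + (q + _)]addrACA.
  by rewrite [LHS]addrACA [_ + (c - d)]addrACA addNr subrr !addr0.
by rewrite E.
Qed.

(** Norms replace the usual comparison of the spectra of $y^*y$ and $yy^*$. With $e=n^2$,
    $t=\|y\|^2=\|e\|$ and $w=t-yy^*$, one has $y^*w^2y=-(t+e)^2e$. Its norm is at most $t^3$ because
    $\|w\|\le t$, and at least $2t^3$ because $(t+e)^2e\ge2te^2$; hence $t=0$. *)
Lemma cstar_neg_sqr_eq0 y n : star n = n -> star y * y = - (n * n) -> y = 0.
Proof.
move=> nn yn; set e := n * n in yn; set t := cnorm y ^+ 2.
have es : star e = e by rewrite starM nn.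
have [u [v [us vs uv]]] := re_im_decomp y.
set z := y * star y in uv.
have pz : cpos z.
  have -> : z = (u * u + v * v) + (u * u + v * v) + e by rewrite -uv yn addrAC addNr add0r.
  by do !apply: cposD; apply: cpos_sqr.
have zs := cpos_star pz.
have zt : cnorm z = t by rewrite /z -{1}(starK y) cstar_identity cnorm_star.
have et : cnorm e = t by rewrite -cnormN -yn cstar_identity.
have t0 : 0 <= t by rewrite sqr_ge0.
pose w := t *# 1 - z.
have wt : cnorm w <= t by apply: cpos_norm => //; rewrite zt.
have zy : star y * z = - (e * star y) by rewrite mulrA yn mulNr.
have yw : star y * w = (t *# 1 + e) * star y.
  by rewrite mulrBr zy opprK mulrDl -scalerAl -scalerAr mulr1 mul1r.
have E : star y * w * w * y = - ((t *# 1 + e) * (t *# 1 + e) * e).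
  rewrite yw -(mulrA _ (star y) w).
 by rewrite yw mulrA -mulrA yn mulrN.
have n1 : cnorm ((t *# 1 + e) * (t *# 1 + e) * e) <= t * t * t.
  rewrite -cnormN -E; set Y := cnorm y.
  have h1 := ler_cnormM (star y * w * w) y; have h2 := ler_cnormM (star y * w) w.
  have h3 := ler_cnormM (star y) w; rewrite cnorm_star -/Y in h1 h3.
  have Y0 : 0 <= Y by apply: cnorm_ge0.
  apply: le_trans h1 _.
  have h4 : cnorm (star y * w * w) <= Y * t * t.
    apply: le_trans h2 _; apply: ler_pM; rewrite ?cnorm_ge0 //.
    by apply: le_trans h3 _; apply: ler_wpM2l.
  have := ler_wpM2r Y0 h4; have : t = Y ^+ 2 by []; nra.
have n2 : cnorm ((2 * t) *# (e * e)) <= cnorm ((t *# 1 + e) * (t *# 1 + e) * e).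
  apply: cpos_norm_le.
    by apply: cposZ; [rewrite mulr_ge0|apply: cpos_sqr].
  have -> (s : R) : (s *# 1 + e) * (s *# 1 + e) * e - (2 * s) *# (e * e) =
      (s * s) *# e + (e * e) * e.
    rewrite mulrDr !mulrDl -!scalerAr -!scalerAl !(mul1r, mulr1) rscaleA.
    by rewrite addrA -(addrA (_ *# e)) rscaleD -mulr2n -mulr_natl addrAC addrK.
  apply: cposD; first by apply: cposZ; [rewrite mulr_ge0|apply: cpos_sqr].
  exists (e * n); rewrite starM nn es; split; first by rewrite /e mulrA.
  by rewrite {3}/e -!mulrA; congr (_ * _); rewrite /e !mulrA.
have : t = 0.
  have t2 : 0 <= 2 * t by lra.
  move: (le_trans n2 n1); rewrite cnormR (cnorm_sqr es) et ger0_norm //.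
  move=> h; apply/eqP; rewrite eq_le t0 andbT leNgt; apply/negP => tp.
  have := mulr_gt0 (mulr_gt0 tp tp) tp; nra.
by move/eqP; rewrite sqrf_eq0 => /eqP/cnorm_eq0.
Qed.

(* With h = x^* x and |h| = r^2, the element y = x(|h| - h) satisfies
   y^* y = - ((|h| - h) r)^2, hence y = 0, and then h = |h|. *)
Lemma cpos_starM x : cpos (star x * x).
Proof.
set h := star x * x; have hs : star h = h by rewrite starM starK.
have hhs : star (h * h) = h * h by rewrite starM hs.
have [k [ks kE kt kc]] := sqrt_near_scalar hhs (cpos_norm (cpos_sqr hs) (lexx _)).
have [r [rs rE _ rc]] := sqrt_near_scalar ks kt.
have hk : h * k = k * h by apply: kc; rewrite mulrA.
have hr : h * r = r * h by apply: rc.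
have kr : k * r = r * k by apply: rc.
pose b := k - h.
have bs : star b = b by rewrite starB ks hs.
have br : b * r = r * b by rewrite mulrBl mulrBr kr hr.
have bh : b * h = - (b * k).
  apply/eqP; rewrite -addr_eq0 -mulrDr mulrBl !mulrDr kE hk.
  by rewrite [k * h + _]addrC subrr.
have n0 : star (b * r) = b * r by rewrite starM rs bs br.
have y0 : x * b = 0.
  apply: (cstar_neg_sqr_eq0 n0).
  rewrite starM bs.
  rewrite mulrA -(mulrA b (star x)) -/h mulrA bh mulNr; congr (- _).
  by rewrite -(mulrA _ b r) {2}br -rE !mulrA.
(* As $bh=-bk$ and $xb=0$: $(br)^2=bkb=-bhb=-bx^*(xb)=0$. *)
have b3 : b * r = 0.
  apply: cnorm_eq0; apply/eqP; rewrite -sqrf_eq0 -cnorm_sqr //.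
  suff -> : (b * r) * (b * r) = 0 by rewrite cnorm0.
  by rewrite {2}br !mulrA -(mulrA b r) rE -[b * k]opprK -bh
    mulNr -mulrA -/h -mulrA y0 !mulr0 oppr0.
have bk : b * k = 0 by rewrite -rE mulrA b3 mul0r.
have b0 : b = 0.
  apply: cnorm_eq0; apply/eqP; rewrite -sqrf_eq0 -cnorm_sqr //.
  by rewrite {2}/b mulrBr bh bk oppr0 subr0 cnorm0.
have -> : h = k by apply/eqP; rewrite eq_sym -subr_eq0 -/b b0.
by rewrite -rE; apply: cpos_sqr.
Qed.

Lemma cpos_conj a h : cpos h -> cpos (star a * h * a).
Proof.
case=> k [kk ->]; have -> : star a * (k * k) * a = star (k * a) * (k * a).
  by rewrite starM kk !mulrA.
exact: cpos_starM.
Qed.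

(** The norm criterion is a closed condition, and $t=\|h\|+1$ bounds [u n] from some index on; the
    roots of the [u n] are never compared. *)
Lemma cvg_cnorm_cpos (u : nat -> A) h :
  cvg_cnorm u h -> (forall n, cpos (u n)) -> cpos h.
Proof.
move=> uh pu; apply: (@cpos_of_norm _ (cnorm h + 1)).
  apply: (cvg_cnorm_unique (cvg_cnorm_star uh)).
  by rewrite (_ : (fun n => star (u n)) = u) //; apply: boolp.funext => n; rewrite cpos_star.
have [N hN] := uh 1 ltr01.
have vh : cvg_cnorm (fun n => (cnorm h + 1) *# 1 - u n) ((cnorm h + 1) *# 1 - h).
  by apply: (cvg_cnorm_lip (C := 1)) uh => n; rewrite mul1r opprB addrC addrA subrK cnorm_distC.
apply: (cvg_cnorm_le vh (N := N)) => n /hN un; apply: cpos_norm => //.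
rewrite -(subrK h (u n)) addrC; apply: le_trans (ler_cnormD _ _) _; lra.
Qed.

(* The quadratic form is evaluated at t = Z / l for l >= ||X||. *)
Lemma cauchy_schwarz_cpos X Y Z : cpos X ->
  (forall a, cpos (star a * X * a - star a * Z - star Z * a + Y)) ->
  cnorm Z ^+ 2 <= cnorm X * cnorm Y.
Proof.
move=> pX H.
have Hl (l : R) : 0 < l -> cnorm X <= l -> cnorm Z ^+ 2 <= l * cnorm Y.
  move=> l0 Xl; have li : 0 <= l^-1 by rewrite invr_ge0 ltW.
  rewrite -ler_pdivrMl // -{1}(ger0_norm li) -cstar_identity -cnormR.
  apply: cpos_norm_le; first by apply: cposZ => //; apply: cpos_starM.
  have p1 := H (l^-1 *# Z).
  (* This adds $l^{-1}Z^*Z-l^{-2}Z^*XZ$ to the form at $Z/l$ and leaves $Y-l^{-1}Z^*Z$. *)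
  have p2 := cposZ (mulr_ge0 li li) (cpos_conj Z (cpos_scalarB (cpos_star pX) Xl)).
  have := cposD p1 p2; rewrite starR mulrBr mulrBl scalerBr.
  rewrite -!scalerAl -!scalerAr -!scalerAl mulr1 !rscaleA.
  rewrite divfK ?gt_eqF //.
  suff E a b y : a - b - b + y + (b - a) = y - b by rewrite E.
  by rewrite addrC !addrA subrK subrr add0r addrC.
apply/ler_addgt0Pr => e e0.
have Y0 : 0 < cnorm Y + 1 by rewrite ltr_wpDl ?cnorm_ge0.
(* As $\|X\|$ may vanish, $l$ is taken above it by an amount that changes $l\|Y\|$ by at most
   $e$. *)
have d0 : 0 < e / (cnorm Y + 1) by rewrite divr_gt0.
have := Hl (cnorm X + e / (cnorm Y + 1)).
rewrite ltr_wpDl ?cnorm_ge0 // lerDl ltW // => /(_ isT isT) h.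
apply: le_trans h _; rewrite mulrDl lerD2l mulrAC ler_pdivrMr // ler_pM2l // lerDl ler01 //.
Qed.

End PositiveElements.

(** * Algebra-valued semi-inner products *)

Section SemiInnerProduct.
Variables (R : realType) (A : cstarAlgType R).

(* Right A-modules with an A-valued positive form, linear in the second
   variable; only the compatibility of the action with the form matters. *)
Record semi_inner (V : lmodType R[i]) (ip : V -> V -> A) (ract : V -> A -> V) : Prop :=
  SemiInner {
  ipDr : forall x y z, ip x (y + z) = ip x y + ip x z;
  ipZr : forall c x y, ip x (c *: y) = c *: ip x y;
  ip_ract : forall x y a, ip x (ract y a) = ip x y * a;
  ip_star : forall x y, star (ip x y) = ip y x;
  ip_cpos : forall x, cpos (ip x x)
}.

Variables (V : lmodType R[i]) (ip : V -> V -> A) (ract : V -> A -> V).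
Hypothesis ipP : semi_inner ip ract.

Definition ipnorm (x : V) : R := Num.sqrt (cnorm (ip x x)).

Lemma ipnorm_ge0 x : 0 <= ipnorm x.
Proof. exact: sqrtr_ge0. Qed.

Lemma ipnorm_sqr x : ipnorm x ^+ 2 = cnorm (ip x x).
Proof. by rewrite sqr_sqrtr ?cnorm_ge0. Qed.

Lemma ipDl x y z : ip (x + y) z = ip x z + ip y z.
Proof. by rewrite -[LHS](starK) (ip_star ipP) (ipDr ipP) starD !(ip_star ipP). Qed.

Lemma ipZl c x y : ip (c *: x) y = conjc c *: ip x y.
Proof. by rewrite -[LHS](starK) (ip_star ipP) (ipZr ipP) starZ !(ip_star ipP). Qed.

Lemma ip_ractl x y a : ip (ract x a) y = star a * ip x y.
Proof. by rewrite -[LHS](starK) (ip_star ipP) (ip_ract ipP) starM !(ip_star ipP). Qed.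

Lemma ipNr x y : ip x (- y) = - ip x y.
Proof. by rewrite -scaleN1r (ipZr ipP) scaleN1r. Qed.

Lemma ipNl x y : ip (- x) y = - ip x y.
Proof. by rewrite -[LHS](starK) (ip_star ipP) ipNr starN !(ip_star ipP). Qed.

Lemma ipBr x y z : ip x (y - z) = ip x y - ip x z.
Proof. by rewrite (ipDr ipP) ipNr. Qed.

Lemma ipBl x y z : ip (x - y) z = ip x z - ip y z.
Proof. by rewrite ipDl ipNl. Qed.

Lemma ip0r x : ip x 0 = 0.
Proof. by rewrite -(subrr 0) ipBr subrr. Qed.

Lemma ipnormN x : ipnorm (- x) = ipnorm x.
Proof. by rewrite /ipnorm ipNr ipNl opprK. Qed.

Lemma ipnorm_distC x y : ipnorm (x - y) = ipnorm (y - x).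
Proof. by rewrite -ipnormN opprB. Qed.

Lemma ipnormZ c x : ipnorm (c *: x) = Normc.normc c * ipnorm x.
Proof.
rewrite /ipnorm (ipZr ipP) ipZl scalerA cnormZ.
rewrite Normc.normcM [Normc.normc (conjc c)](_ : _ = Normc.normc c); last first.
  by case: c => a b; rewrite /= sqrrN.
by rewrite sqrtrM -?expr2 ?sqr_ge0 // sqrtr_sqr ger0_norm //; case: c => a b; apply: sqrtr_ge0.
Qed.

Lemma cauchy_schwarz x y : cnorm (ip x y) <= ipnorm x * ipnorm y.
Proof.
rewrite -ler_sqr ?nnegrE ?mulr_ge0 ?ipnorm_ge0 ?cnorm_ge0 // exprMn !ipnorm_sqr.
apply: cauchy_schwarz_cpos (ip_cpos ipP x) _ => a.
have := ip_cpos ipP (ract x a - y).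
rewrite ipBr !ipBl !ip_ractl !(ip_ract ipP) (ip_star ipP) opprB mulrA.
by rewrite [ip y y - _]addrC addrA [_ - _ - _ in X in X -> _]addrAC.
Qed.

Lemma ler_ipnormD x y : ipnorm (x + y) <= ipnorm x + ipnorm y.
Proof.
rewrite -ler_sqr ?nnegrE ?addr_ge0 ?ipnorm_ge0 // ipnorm_sqr (ipDr ipP) !ipDl.
have := cauchy_schwarz x y; have := cauchy_schwarz y x.
have := ler_cnormD (ip x x + ip y x) (ip x y + ip y y).
have := ler_cnormD (ip x x) (ip y x); have := ler_cnormD (ip x y) (ip y y).
have := ipnorm_sqr x; have := ipnorm_sqr y; nra.
Qed.

Lemma ler_ipnorm_dist y x z : ipnorm (x - z) <= ipnorm (x - y) + ipnorm (y - z).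
Proof. by rewrite -{1}(subrK y x) -addrA; apply: ler_ipnormD. Qed.

End SemiInnerProduct.

(** * Hilbert modules *)

Section HilbertModules.
Variables (R : realType) (A : cstarAlgType R).

(** [hm_neq0] makes $1\neq0$ in the algebra of operators, as the algebra structure demands. *)
Record hilbertModule := HilbertModule {
  hm_sort :> lmodType R[i];
  hm_ip : hm_sort -> hm_sort -> A;
  hm_ract : hm_sort -> A -> hm_sort;
  hm_semi_inner : semi_inner hm_ip hm_ract;
  hm_ip_eq0 : forall x, hm_ip x x = 0 -> x = 0;
  hm_complete : forall u : nat -> hm_sort,
    (forall e : R, 0 < e -> exists N : nat, forall i j : nat,
       (N <= i)%N -> (N <= j)%N -> ipnorm hm_ip (u i - u j) < e) ->
    exists l, forall e : R, 0 < e -> exists N : nat, forall i : nat,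
       (N <= i)%N -> ipnorm hm_ip (u i - l) < e;
  hm_neq0 : exists x : hm_sort, x != 0
}.

End HilbertModules.

(** * The C*-algebra of adjointable operators *)

Section AdjointableOperators.
Variables (R : realType) (A : cstarAlgType R) (H : hilbertModule A).
Local Notation ip := (@hm_ip R A H).
Local Notation hnorm := (ipnorm ip).
Local Notation ipP := (hm_semi_inner H).
Implicit Types (x y z : H) (c : R[i]).

Lemma hnorm_eq0 x : hnorm x = 0 -> x = 0.
Proof.
by move=> h; apply/hm_ip_eq0/cnorm_eq0; rewrite -ipnorm_sqr h expr0n.
Qed.

Lemma ip_inj x y : (forall z, ip z x = ip z y) -> x = y.
Proof.
move=> h; apply/eqP; rewrite -subr_eq0; apply/eqP/hm_ip_eq0.
by rewrite (ipBr ipP) h subrr.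
Qed.

Definition adjoint_pair (T S : H -> H) : Prop := forall x y, ip (T x) y = ip x (S y).

Definition bounded_op (T : H -> H) : Prop :=
  exists C : R, 0 <= C /\ forall x, hnorm (T x) <= C * hnorm x.

Definition is_adjointable T : Prop := (exists S, adjoint_pair T S) /\ bounded_op T.

(** Linearity follows from the existence of an adjoint, see [adj_additive] and [adj_scalable];
    equality of operators is equality of functions. *)
Record adjointable := Adjointable {
  adj_fun :> H -> H;
  adj_funP : is_adjointable adj_fun
}.

HB.instance Definition _ := gen_eqMixin adjointable.
HB.instance Definition _ := gen_choiceMixin adjointable.

Lemma adjointable_eq (T S : adjointable) : (forall x, T x = S x) -> T = S.
Proof.
case: T S => [T hT] [S hS] /= /funext TS; case: S / TS hS => hS.
by congr Adjointable; apply: Prop_irrelevance.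
Qed.

Lemma adjoint_pair_sym T S : adjoint_pair T S -> adjoint_pair S T.
Proof. by move=> h x y; rewrite -(ip_star ipP) -h (ip_star ipP). Qed.

Lemma adjoint_pairD T S x y : adjoint_pair T S -> T (x + y) = T x + T y.
Proof.
move=> /adjoint_pair_sym h; apply: ip_inj => z.
by rewrite (ipDr ipP) -!h (ipDr ipP).
Qed.

Lemma adjoint_pairZ T S c x : adjoint_pair T S -> T (c *: x) = c *: T x.
Proof.
move=> /adjoint_pair_sym h; apply: ip_inj => z.
by rewrite (ipZr ipP) -!h (ipZr ipP).
Qed.

Lemma adjoint_pair_bound T S (C : R) : adjoint_pair T S -> 0 <= C ->
  (forall x, hnorm (T x) <= C * hnorm x) -> forall x, hnorm (S x) <= C * hnorm x.
Proof.
move=> TS C0 hC x; have := ipnorm_ge0 ip (S x); rewrite le_eqVlt => /orP[/eqP<-|S0].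
  by rewrite mulr_ge0 ?ipnorm_ge0.
rewrite -(ler_pM2r S0) -expr2 ipnorm_sqr -TS.
apply: le_trans (cauchy_schwarz ipP _ _) _.
by rewrite mulrAC; apply: ler_wpM2r; rewrite ?ipnorm_ge0.
Qed.

Lemma is_adjointable_adj T S : adjoint_pair T S -> bounded_op T -> is_adjointable S.
Proof.
move=> TS [C [C0 hC]]; split; first by exists T; apply: adjoint_pair_sym.
by exists C; split=> //; apply: adjoint_pair_bound TS C0 hC.
Qed.

Lemma is_adjointable0 : is_adjointable (fun=> 0).
Proof.
split; first by exists (fun=> 0) => x y; rewrite (ip0r ipP) -(ip_star ipP) (ip0r ipP) star0.
by exists 0; split=> // x; rewrite mul0r /ipnorm (ip0r ipP) cnorm0 sqrtr0.
Qed.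

Lemma is_adjointable1 : is_adjointable id.
Proof. by split; [exists id|exists 1; split=> // x; rewrite mul1r]. Qed.

Lemma is_adjointableD (T S : adjointable) : is_adjointable (fun x => T x + S x).
Proof.
case: T S => [T [[T' hT] [C [C0 hC]]]] [S [[S' hS] [D [D0 hD]]]] /=; split.
  by exists (fun x => T' x + S' x) => x y; rewrite (ipDl ipP) (ipDr ipP) hT hS.
exists (C + D); split=> [|x]; first exact: addr_ge0.
by apply: le_trans (ler_ipnormD ipP _ _) _; rewrite mulrDl lerD.
Qed.

Lemma is_adjointableZ c (T : adjointable) : is_adjointable (fun x => c *: T x).
Proof.
case: T => [T [[T' hT] [C [C0 hC]]]] /=; split.
  exists (fun x => conjc c *: T' x) => x y.
  by rewrite (ipZl ipP) (ipZr ipP) hT.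
have c0 : 0 <= Normc.normc c by case: c => a b; apply: sqrtr_ge0.
exists (Normc.normc c * C); split=> [|x]; first exact: mulr_ge0.
by rewrite (ipnormZ ipP) -mulrA ler_wpM2l.
Qed.

Lemma is_adjointableM (T S : adjointable) : is_adjointable (fun x => T (S x)).
Proof.
case: T S => [T [[T' hT] [C [C0 hC]]]] [S [[S' hS] [D [D0 hD]]]] /=; split.
  by exists (fun x => S' (T' x)) => x y; rewrite hT hS.
exists (C * D); split=> [|x]; first exact: mulr_ge0.
by apply: le_trans (hC _) _; rewrite -mulrA ler_wpM2l.
Qed.

Definition adj0 := Adjointable is_adjointable0.
Definition adj1 := Adjointable is_adjointable1.
Definition adjD T S := Adjointable (is_adjointableD T S).
Definition adjZ c T := Adjointable (is_adjointableZ c T).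
Definition adjM T S := Adjointable (is_adjointableM T S).

Lemma adj_additive (T : adjointable) x y : T (x + y) = T x + T y.
Proof. by case: (adj_funP T) => -[S /adjoint_pairD]. Qed.

Lemma adj_scalable (T : adjointable) c x : T (c *: x) = c *: T x.
Proof. by case: (adj_funP T) => -[S /adjoint_pairZ]. Qed.

Lemma adjDA : associative adjD.
Proof. by move=> T S U; apply: adjointable_eq => x /=; rewrite addrA. Qed.
Lemma adjDC : commutative adjD.
Proof. by move=> T S; apply: adjointable_eq => x /=; rewrite addrC. Qed.
Lemma adj0D : left_id adj0 adjD.
Proof. by move=> T; apply: adjointable_eq => x /=; rewrite add0r. Qed.
Lemma adjND : left_inverse adj0 (adjZ (-1)) adjD.
Proof. by move=> T; apply: adjointable_eq => x /=; rewrite scaleN1r addNr. Qed.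

HB.instance Definition _ := GRing.isZmodule.Build adjointable adjDA adjDC adj0D adjND.

Lemma adjMA : associative adjM.
Proof. by move=> T S U; apply: adjointable_eq. Qed.
Lemma adj1M : left_id adj1 adjM.
Proof. by move=> T; apply: adjointable_eq. Qed.
Lemma adjM1 : right_id adj1 adjM.
Proof. by move=> T; apply: adjointable_eq. Qed.
Lemma adjMDl : left_distributive adjM +%R.
Proof. by move=> T S U; apply: adjointable_eq. Qed.
Lemma adjMDr : right_distributive adjM +%R.
Proof. by move=> T S U; apply: adjointable_eq => x /=; rewrite adj_additive. Qed.
Lemma adj1_neq0 : adj1 != 0.
Proof.
apply/eqP => /(congr1 (fun T : adjointable => adj_fun T)) h.
have [x /eqP] := hm_neq0 H; apply.
by have := congr1 (fun f => f x) h.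
Qed.

HB.instance Definition _ := GRing.Zmodule_isNzRing.Build adjointable
  adjMA adj1M adjM1 adjMDl adjMDr adj1_neq0.

Lemma adjZA c d T : adjZ c (adjZ d T) = adjZ (c * d) T.
Proof. by apply: adjointable_eq => x /=; rewrite scalerA. Qed.
Lemma adj1Z : left_id 1 adjZ.
Proof. by move=> T; apply: adjointable_eq => x /=; rewrite scale1r. Qed.
Lemma adjZDr : right_distributive adjZ +%R.
Proof. by move=> c T S; apply: adjointable_eq => x /=; rewrite scalerDr. Qed.
Lemma adjZDl T : {morph adjZ^~ T : c d / c + d}.
Proof. by move=> c d; apply: adjointable_eq => x /=; rewrite scalerDl. Qed.

HB.instance Definition _ := GRing.Zmodule_isLmodule.Build R[i] adjointable
  adjZA adj1Z adjZDr adjZDl.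

Lemma adjZMl c (T S : adjointable) : c *: (T * S) = (c *: T) * S.
Proof. exact: adjointable_eq. Qed.
HB.instance Definition _ := GRing.Lmodule_isLalgebra.Build R[i] adjointable adjZMl.

Lemma adjZMr c (T S : adjointable) : c *: (T * S) = T * (c *: S).
Proof. by apply: adjointable_eq => x /=; rewrite adj_scalable. Qed.
HB.instance Definition _ := GRing.Lalgebra_isAlgebra.Build R[i] adjointable adjZMr.

Lemma adj_ex (T : adjointable) : exists S : adjointable, adjoint_pair T S.
Proof.
by case: T => [T [[S TS] hT]]; exists (Adjointable (is_adjointable_adj TS hT)).
Qed.

Definition adj (T : adjointable) : adjointable := sval (cid (adj_ex T)).

Lemma adjP (T : adjointable) : adjoint_pair T (adj T).
Proof. exact: svalP (cid (adj_ex T)). Qed.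

Lemma adj_unique (T S : adjointable) : adjoint_pair T S -> adj T = S.
Proof. by move=> TS; apply: adjointable_eq => x; apply: ip_inj => z; rewrite -TS adjP. Qed.

Lemma adj_isD : {morph adj : T S / T + S}.
Proof.
by move=> T S; apply: adj_unique => x y; rewrite (ipDl ipP) (ipDr ipP) !adjP.
Qed.
Lemma adj_isZ c T : adj (c *: T) = conjc c *: adj T.
Proof. by apply: adj_unique => x y; rewrite (ipZl ipP) (ipZr ipP) adjP. Qed.
Lemma adj_isM T S : adj (T * S) = adj S * adj T.
Proof. by apply: adj_unique => x y; rewrite /= !adjP. Qed.
Lemma adj_isK : involutive adj.
Proof. by move=> T; apply/adj_unique/adjoint_pair_sym/adjP. Qed.

Definition opnorm_bounds (T : adjointable) : set R :=
  [set C | 0 <= C /\ forall x, hnorm (T x) <= C * hnorm x].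

Definition opnorm T : R := inf (opnorm_bounds T).

Lemma opnorm_bounds_has_inf T : has_inf (opnorm_bounds T).
Proof.
split; last by exists 0 => C [].
by case: (adj_funP T) => _ [C hC]; exists C.
Qed.

Lemma opnorm_ge0 T : 0 <= opnorm T.
Proof. by apply: lb_le_inf => [|C []//]; case: (opnorm_bounds_has_inf T). Qed.

Lemma opnorm_le (T : adjointable) (C : R) :
  0 <= C -> (forall x, hnorm (T x) <= C * hnorm x) -> opnorm T <= C.
Proof. by move=> C0 hC; apply: ge_inf; [case: (opnorm_bounds_has_inf T)|split]. Qed.

Lemma ler_opnorm (T : adjointable) x : hnorm (T x) <= opnorm T * hnorm x.
Proof.
have := ipnorm_ge0 ip x; rewrite le_eqVlt => /orP[/eqP x0|x0].
  by case: (adj_funP T) => _ [C [_ /(_ x)]]; rewrite -x0 !mulr0.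
rewrite -ler_pdivrMr //; apply: lb_le_inf; first by case: (opnorm_bounds_has_inf T).
by move=> C [_ /(_ x)]; rewrite ler_pdivrMr.
Qed.

Lemma opnorm_eq0 T : opnorm T = 0 -> T = 0.
Proof.
move=> T0; apply: adjointable_eq => x; apply: hnorm_eq0; apply/eqP.
by rewrite eq_le ipnorm_ge0 andbT (le_trans (ler_opnorm _ _)) // T0 mul0r.
Qed.

Lemma opnormZ_le c T : opnorm (c *: T) <= Normc.normc c * opnorm T.
Proof.
have c0 : 0 <= Normc.normc c by case: c => a b; apply: sqrtr_ge0.
apply: opnorm_le => [|x]; first by rewrite mulr_ge0 ?opnorm_ge0.
by rewrite [hnorm _](ipnormZ ipP) -mulrA ler_wpM2l // ler_opnorm.
Qed.

Lemma opnormZ c T : opnorm (c *: T) = Normc.normc c * opnorm T.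
Proof.
have [->|c0] := eqVneq c 0.
  apply/eqP; rewrite eq_le opnormZ_le Normc.normc0 mul0r; exact: opnorm_ge0.
apply/eqP; rewrite eq_le opnormZ_le andTb.
have cn0 : 0 < Normc.normc c.
  rewrite lt_neqAle eq_sym; apply/andP; split; last by case: (c) => a b; apply: sqrtr_ge0.
  by apply/eqP => /Normc.eq0_normc/eqP; apply/negP.
rewrite mulrC -ler_pdivlMr // mulrC -Normc.normcV.
by rewrite -{1}(scale1r T) -(mulVf c0) -scalerA opnormZ_le.
Qed.

Lemma ler_opnormD T S : opnorm (T + S) <= opnorm T + opnorm S.
Proof.
apply: opnorm_le => [|x]; first by rewrite addr_ge0 ?opnorm_ge0.
by apply: le_trans (ler_ipnormD ipP _ _) _; rewrite mulrDl lerD // ler_opnorm.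
Qed.

Lemma ler_opnormM T S : opnorm (T * S) <= opnorm T * opnorm S.
Proof.
apply: opnorm_le => [|x]; first by rewrite mulr_ge0 ?opnorm_ge0.
by apply: le_trans (ler_opnorm T (S x)) _; rewrite -mulrA ler_wpM2l ?opnorm_ge0 ?ler_opnorm.
Qed.

Lemma opnorm_adj T : opnorm (adj T) = opnorm T.
Proof.
suff h S : opnorm (adj S) <= opnorm S by apply/eqP; rewrite eq_le h -{1}(adj_isK T) h.
apply: opnorm_le; first exact: opnorm_ge0.
exact: adjoint_pair_bound (adjP S) (opnorm_ge0 S) (ler_opnorm S).
Qed.

Lemma opnorm_cstar T : opnorm (adj T * T) = opnorm T ^+ 2.
Proof.
apply/eqP; rewrite eq_le; apply/andP; split.
  by apply: le_trans (ler_opnormM _ _) _; rewrite opnorm_adj.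
rewrite -[leRHS]sqr_sqrtr ?opnorm_ge0 // ler_sqr ?nnegrE ?opnorm_ge0 ?sqrtr_ge0 //.
apply: opnorm_le => [|x]; first exact: sqrtr_ge0.
have Tx : hnorm (T x) ^+ 2 = cnorm (ip x ((adj T * T) x)) by rewrite ipnorm_sqr adjP.
rewrite -ler_sqr ?nnegrE ?mulr_ge0 ?sqrtr_ge0 ?ipnorm_ge0 // exprMn Tx.
rewrite (sqr_sqrtr (opnorm_ge0 _)); apply: le_trans (cauchy_schwarz ipP _ _) _.
by rewrite expr2 mulrA mulrC ler_wpM2r ?ipnorm_ge0 // ler_opnorm.
Qed.

Lemma adjB_apply (T S : adjointable) x : (T - S) x = T x - S x.
Proof. by rewrite /= scaleN1r. Qed.

(** The module is complete, so pointwise limits exist, but the limit also needs an adjoint. The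
    adjoints of [u] have the same mutual distances as [u], so [limit] applies to them too, and the
    two limits form an adjoint pair. *)
Lemma opnorm_complete (u : nat -> adjointable) :
  (forall e : R, 0 < e -> exists N : nat, forall i j : nat,
     (N <= i)%N -> (N <= j)%N -> opnorm (u i - u j) < e) ->
  exists l, forall e : R, 0 < e -> exists N : nat, forall i : nat,
     (N <= i)%N -> opnorm (u i - l) < e.
Proof.
move=> cu.
have limit (v : nat -> adjointable) :
    (forall i j, opnorm (v i - v j) = opnorm (u i - u j)) ->
    exists T : H -> H, forall e : R, 0 < e -> exists N : nat, forall i : nat,
      (N <= i)%N -> forall x, hnorm (v i x - T x) <= e * hnorm x.
  move=> vu.
  have cx x : exists l, forall e : R, 0 < e -> exists N : nat, forall i : nat,
      (N <= i)%N -> hnorm (v i x - l) < e.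
    apply: hm_complete => e e0.
    have x0 : 0 < hnorm x + 1 by rewrite ltr_wpDl ?ipnorm_ge0.
    have [N hN] := cu (e / (hnorm x + 1)) (divr_gt0 e0 x0).
    exists N => i j Ni Nj; rewrite -adjB_apply; apply: le_lt_trans (ler_opnorm _ _) _.
    rewrite vu; have := hN i j Ni Nj; rewrite ltr_pdivlMr //; apply: le_lt_trans.
    by rewrite ler_wpM2l ?opnorm_ge0 // lerDl.
  have [T hT] := choice cx; exists T => e /cu[N hN]; exists N => i Ni x.
  apply/ler_addgt0Pr => d /(hT x)[M hM].
  have := hN i (maxn N M) Ni (leq_maxl N M); rewrite -vu => h1.
  have h2 := hM _ (leq_maxr N M).
  apply: le_trans (ler_ipnorm_dist ipP (v (maxn N M) x) _ _) _; apply: lerD; last exact: ltW.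
  rewrite -adjB_apply; apply: le_trans (ler_opnorm _ _) _.
  by rewrite ler_wpM2r ?ipnorm_ge0 // ltW.
have [T hT] := limit u (fun _ _ => erefl).
have [S hS] : exists S : H -> H, forall e : R, 0 < e -> exists N : nat, forall i : nat,
      (N <= i)%N -> forall x, hnorm (adj (u i) x - S x) <= e * hnorm x.
  apply: (limit (fun i => adj (u i))) => i j.
  by rewrite -(opnorm_adj (u i - u j)) adj_isD -scaleN1r adj_isZ rmorphN1 scaleN1r.
have TS : adjoint_pair T S.
  move=> x y; apply/eqP; rewrite -subr_eq0; apply/eqP/cnorm_eq0/eqP.
  rewrite eq_le cnorm_ge0 andbT; apply/ler_addgt0Pr => e e0.
  set K := hnorm x * hnorm y.
  have K0 : 0 <= K by rewrite mulr_ge0 ?ipnorm_ge0.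
  (* Each of the two error terms below is at most $dK$ with $d=e/(2(K+1))$; the added $1$ keeps the
     divisor positive when $K=0$. *)
  have K1 : 0 < 2 * (K + 1) by rewrite mulr_gt0 // ltr_wpDl.
  have [N hN] := hT _ (divr_gt0 e0 K1); have [M hM] := hS _ (divr_gt0 e0 K1).
  have := hN _ (leq_maxl N M) x; have := hM _ (leq_maxr N M) y.
  set n := maxn N M; set d := e / _ => h1 h2.
  have -> : ip (T x) y - ip x (S y) = ip x (adj (u n) y - S y) - ip (u n x - T x) y.
    by rewrite (ipBr ipP) (ipBl ipP) adjP opprB addrC [RHS]addrC addrA subrK addrC.
  have h3 := ler_cnormB (ip x (adj (u n) y - S y)) (ip (u n x - T x) y).
  have h4 := cauchy_schwarz ipP x (adj (u n) y - S y).
  have h5 := cauchy_schwarz ipP (u n x - T x) y.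
  have x0 := ipnorm_ge0 ip x; have y0 := ipnorm_ge0 ip y.
  have h6 := ler_wpM2l x0 h1; have h7 := ler_wpM2r y0 h2.
  have : 2 * (d * K) <= e.
    by rewrite mulrCA /d mulrAC ler_pdivrMr // ler_wpM2l ?(ltW e0) //; lra.
  rewrite /K; nra.
have bT : bounded_op T.
  have [N hN] := hT 1 ltr01; exists (1 + opnorm (u N)); split=> [|x].
    by rewrite addr_ge0 ?opnorm_ge0.
  have := hN N (leqnn N) x; have := ler_opnorm (u N) x.
  rewrite (ipnorm_distC ipP) => h1 h2.
  rewrite -(subrK (u N x) (T x)); apply: le_trans (ler_ipnormD ipP _ _) _; lra.
exists (Adjointable (conj (ex_intro _ S TS) bT)) => e e0.
have [N hN] := hT (e / 2) (divr_gt0 e0 (ltr0n _ 2)).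
exists N => i /hN h; apply: (@le_lt_trans _ _ (e / 2)); last by lra.
by apply: opnorm_le => [|x]; [lra|rewrite adjB_apply].
Qed.

HB.instance Definition _ := isCStarAlgebra.Build R adjointable
  adj_isD adj_isZ adj_isM adj_isK opnorm_eq0 opnormZ ler_opnormD ler_opnormM
  opnorm_complete opnorm_cstar.

End AdjointableOperators.

(** * The Hilbert module of square-summable sequences *)

Section SquareSummable.
Variables (R : realType) (A : cstarAlgType R).
Implicit Types (x y z : nat -> A) (m n k : nat) (a : A).

(** On all sequences the form over a finite window is only semi-definite, but Cauchy-Schwarz and the
    triangle inequality hold for it already; the inner product on $l^2(A)$ inherits its properties
    as a limit of such forms. *)
Definition segsum m n x y : A := \sum_(m <= i < n) star (x i) * y i.

Lemma segsum_semi_inner m n :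
  semi_inner (segsum m n) (fun x a i => x i * a).
Proof.
split=> [x y z|c x y|x y a|x y|x]; rewrite /segsum.
- by rewrite -big_split; apply: eq_bigr => i _; rewrite !fctE mulrDr.
- by rewrite scaler_sumr; apply: eq_bigr => i _; rewrite !fctE scalerAr.
- by rewrite mulr_suml; apply: eq_bigr => i _; rewrite mulrA.
- by rewrite star_sum; apply: eq_bigr => i _; rewrite starM starK.
- by apply: cpos_sum => i _; apply: cpos_starM.
Qed.

Local Notation segnorm m n := (ipnorm (segsum m n)).

Lemma segnorm_cat m n k x : (m <= n)%N -> (n <= k)%N ->
  segnorm m n x <= segnorm m k x /\ segnorm n k x <= segnorm m k x.
Proof.
move=> mn nk.
have E : segsum m k x x = segsum m n x x + segsum n k x x by rewrite /segsum (big_cat_nat mn nk).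
have p i j := ip_cpos (segsum_semi_inner i j) x.
split; apply: ler_wsqrtr; apply: cpos_norm_le (p _ _) _; rewrite E.
  by rewrite addrC addKr.
by rewrite addrK.
Qed.

Lemma segnorm_nil m n x : (n <= m)%N -> segnorm m n x = 0.
Proof. by move=> nm; rewrite /ipnorm /segsum big_geq // cnorm0 sqrtr0. Qed.

Lemma segnorm_le m n m' n' x : (m' <= m)%N -> (n <= n')%N ->
  segnorm m n x <= segnorm m' n' x.
Proof.
move=> mm nn; have [nm|mn] := leqP n m; first by rewrite segnorm_nil // ipnorm_ge0.
have [h _] := segnorm_cat x (ltnW mn) nn.
have [_ h'] := segnorm_cat x mm (leq_trans (ltnW mn) nn).
exact: le_trans h h'.
Qed.

Lemma segnorm1 i x : segnorm i i.+1 x = cnorm (x i).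
Proof.
by rewrite /ipnorm /segsum big_nat1 cstar_identity sqrtr_sqr ger0_norm ?cnorm_ge0.
Qed.

Lemma ler_segnorm m n x (t : R) : 0 <= t ->
  cnorm (segsum m n x x) <= t ^+ 2 -> segnorm m n x <= t.
Proof. by move=> t0; rewrite -{2}(ger0_norm t0) -sqrtr_sqr; apply: ler_wsqrtr. Qed.

(** The Cauchy condition for norm convergence of $\sum x_i^*x_i$; for sums in [A], bounded partial
    sums would not ensure convergence. *)
Definition square_summable x : Prop :=
  forall e : R, 0 < e -> exists N : nat, forall m, (N <= m)%N -> forall n, segnorm m n x < e.

Lemma square_summableD x y :
  square_summable x -> square_summable y -> square_summable (x + y).
Proof.
move=> hx hy e e0.
have [N hN] := hx (e / 2) (divr_gt0 e0 (ltr0n _ 2)).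
have [M hM] := hy (e / 2) (divr_gt0 e0 (ltr0n _ 2)).
exists (maxn N M) => m; rewrite geq_max => /andP[/hN {}hN /hM {}hM] n.
have h1 := hN n; have h2 := hM n.
apply: le_lt_trans (ler_ipnormD (segsum_semi_inner m n) _ _) _; lra.
Qed.

Lemma square_summable_lip x y (C : R) :
  (forall m n, segnorm m n y <= C * segnorm m n x) ->
  square_summable x -> square_summable y.
Proof.
move=> yx hx e e0; have C0 : 0 < `|C| + 1 by rewrite ltr_wpDl.
have [N hN] := hx (e / (`|C| + 1)) (divr_gt0 e0 C0).
exists N => m /hN h n; have := h n; rewrite ltr_pdivlMr // => {}h.
apply: le_lt_trans (yx m n) _; apply: le_lt_trans h.
rewrite mulrC ler_wpM2l ?ipnorm_ge0 //; have := ler_norm C; lra.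
Qed.

Lemma square_summableZ c x : square_summable x -> square_summable (c *: x).
Proof.
apply: (@square_summable_lip _ _ (Normc.normc c)) => m n.
by rewrite (ipnormZ (segsum_semi_inner m n)).
Qed.

Lemma square_summable0 : square_summable 0.
Proof.
move=> e e0; exists 0%N => m _ n.
by rewrite /ipnorm (ip0r (segsum_semi_inner m n)) cnorm0 sqrtr0.
Qed.

Lemma segnorm_ract m n x a : segnorm m n (fun i => x i * a) <= cnorm a * segnorm m n x.
Proof.
apply: ler_segnorm; first by rewrite mulr_ge0 ?cnorm_ge0 ?ipnorm_ge0.
have P := segsum_semi_inner m n.
rewrite (ip_ract P) (ip_ractl P) exprMn ipnorm_sqr.
have := ler_cnormM (star a * segsum m n x x) a; have := ler_cnormM (star a) (segsum m n x x).
rewrite cnorm_star => h1 h2; have := ler_wpM2r (cnorm_ge0 a) h1; lra.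
Qed.

(** Unlike the right action, the left one does not factor out of the form. Termwise,
    $\|a\|^2x_i^*x_i-x_i^*a^*ax_i$ is a conjugate of the positive element $\|a\|^2-a^*a$. *)
Lemma segnorm_lact m n x a : segnorm m n (fun i => a * x i) <= cnorm a * segnorm m n x.
Proof.
apply: ler_segnorm; first by rewrite mulr_ge0 ?cnorm_ge0 ?ipnorm_ge0.
rewrite exprMn ipnorm_sqr -(ger0_norm (sqr_ge0 (cnorm a))) -cnormR.
apply: cpos_norm_le; first exact: ip_cpos (segsum_semi_inner m n) _.
rewrite /segsum scaler_sumr -sumrB; apply: cpos_sum => i _.
rewrite starM -mulrA (mulrA (star a)).
have -> : cnorm a ^+ 2 *# (star (x i) * x i) - star (x i) * (star a * a * x i) =
    star (x i) * (cnorm a ^+ 2 *# 1 - star a * a) * x i.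
  by rewrite mulrBr mulrBl -scalerAr -scalerAl mulr1 !mulrA.
apply: cpos_conj; apply: cpos_scalarB; first by rewrite starM starK.
by rewrite cstar_identity.
Qed.

Record ell2 := Ell2 { ell2_val :> nat -> A; ell2P : square_summable ell2_val }.

HB.instance Definition _ := gen_eqMixin ell2.
HB.instance Definition _ := gen_choiceMixin ell2.

Lemma ell2_eq (x y : ell2) : (forall i, x i = y i) -> x = y.
Proof.
case: x y => [x hx] [y hy] /= /funext xy; case: y / xy hy => hy.
by congr Ell2; apply: Prop_irrelevance.
Qed.

Definition ell2_add (x y : ell2) := Ell2 (square_summableD (ell2P x) (ell2P y)).
Definition ell2_scale c (x : ell2) := Ell2 (square_summableZ c (ell2P x)).
Definition ell2_zero := Ell2 square_summable0.

Lemma ell2_addA : associative ell2_add.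
Proof. by move=> x y z; apply: ell2_eq => i /=; rewrite !fctE addrA. Qed.
Lemma ell2_addC : commutative ell2_add.
Proof. by move=> x y; apply: ell2_eq => i /=; rewrite !fctE addrC. Qed.
Lemma ell2_add0 : left_id ell2_zero ell2_add.
Proof. by move=> x; apply: ell2_eq => i /=; rewrite !fctE add0r. Qed.
Lemma ell2_addN : left_inverse ell2_zero (ell2_scale (-1)) ell2_add.
Proof. by move=> x; apply: ell2_eq => i /=; rewrite !fctE scaleN1r addNr. Qed.

HB.instance Definition _ :=
  GRing.isZmodule.Build ell2 ell2_addA ell2_addC ell2_add0 ell2_addN.

Lemma ell2_scaleA c d (x : ell2) : ell2_scale c (ell2_scale d x) = ell2_scale (c * d) x.
Proof. by apply: ell2_eq => i /=; rewrite !fctE scalerA. Qed.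
Lemma ell2_scale1 : left_id 1 ell2_scale.
Proof. by move=> x; apply: ell2_eq => i /=; rewrite !fctE scale1r. Qed.
Lemma ell2_scaleDr : right_distributive ell2_scale +%R.
Proof. by move=> c x y; apply: ell2_eq => i /=; rewrite !fctE scalerDr. Qed.
Lemma ell2_scaleDl (x : ell2) : {morph ell2_scale^~ x : c d / c + d}.
Proof. by move=> c d; apply: ell2_eq => i /=; rewrite !fctE scalerDl. Qed.

HB.instance Definition _ := GRing.Zmodule_isLmodule.Build R[i] ell2
  ell2_scaleA ell2_scale1 ell2_scaleDr ell2_scaleDl.

Lemma segsum_cauchy (x y : ell2) (e : R) : 0 < e -> exists N : nat, forall i j : nat,
  (N <= i)%N -> (N <= j)%N -> cnorm (segsum 0 i x y - segsum 0 j x y) < e.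
Proof.
move=> e0; have [N hN] := ell2P x e0; have [M hM] := ell2P y ltr01.
exists (maxn N M) => i j.
wlog ij : i j / (i <= j)%N.
  move=> W hi hj; have [|/ltnW] := leqP i j; first by move=> ?; apply: W.
  by move=> ji; rewrite cnorm_distC; apply: W.
rewrite geq_max => /andP[/hN/(_ j) {}hN /hM/(_ j) {}hM] _.
have -> : segsum 0 i x y - segsum 0 j x y = - segsum i j x y.
  by rewrite /segsum (big_cat_nat (leq0n i) ij) /= opprD addrA subrr add0r.
rewrite cnormN; apply: le_lt_trans (cauchy_schwarz (segsum_semi_inner i j) _ _) _.
have := ipnorm_ge0 (segsum i j) x; have := ipnorm_ge0 (segsum i j) y; nra.
Qed.

Definition ell2_ip (x y : ell2) : A :=
  sval (cid (cnorm_complete _ (segsum_cauchy x y))).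

Lemma cvg_ell2_ip (x y : ell2) : cvg_cnorm (fun n => segsum 0 n x y) (ell2_ip x y).
Proof. exact: svalP (cid (cnorm_complete _ (segsum_cauchy x y))). Qed.

Definition ell2_ract (x : ell2) a : ell2 :=
  Ell2 (square_summable_lip (fun m n => segnorm_ract m n x a) (ell2P x)).

Lemma ell2_semi_inner : semi_inner ell2_ip ell2_ract.
Proof.
split=> [x y z|c x y|x y a|x y|x].
- apply: (cvg_cnorm_unique (cvg_ell2_ip x (y + z))).
  have := cvg_cnormD (cvg_ell2_ip x y) (cvg_ell2_ip x z).
  by under eq_fun do rewrite -(ipDr (segsum_semi_inner _ _)).
- apply: (cvg_cnorm_unique (cvg_ell2_ip x (c *: y))).
  have := cvg_cnormZ c (cvg_ell2_ip x y).
  by under eq_fun do rewrite -(ipZr (segsum_semi_inner _ _)).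
- apply: (cvg_cnorm_unique (cvg_ell2_ip x (ell2_ract y a))).
  have := cvg_cnormMr a (cvg_ell2_ip x y).
  by under eq_fun do rewrite -(ip_ract (segsum_semi_inner _ _)).
- apply: (cvg_cnorm_unique _ (cvg_ell2_ip y x)).
  have := cvg_cnorm_star (cvg_ell2_ip x y).
  by under eq_fun do rewrite (ip_star (segsum_semi_inner _ _)).
- apply: (cvg_cnorm_cpos (cvg_ell2_ip x x)) => n.
  exact: ip_cpos (segsum_semi_inner 0 n) _.
Qed.

Local Notation ell2norm := (ipnorm ell2_ip).

Lemma segnorm_le_ell2norm m n (x : ell2) : segnorm m n x <= ell2norm x.
Proof.
apply: ler_wsqrtr; apply: cpos_norm_le; first exact: ip_cpos (segsum_semi_inner m n) _.
(* After the shift by [n] every partial sum contains the window, and the difference is a sum of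
   positive terms. *)
have := cvg_cnormD (cvg_cnorm_shift n (cvg_ell2_ip x x)) (cvg_cnorm_cst (- segsum m n x x)).
move/cvg_cnorm_cpos; apply=> k /=.
have [nm|mn] := leqP n m.
  by rewrite {2}/segsum big_geq // subr0; apply: ip_cpos (segsum_semi_inner _ _) _.
rewrite {1}/segsum (big_cat_nat (leq0n n) (leq_addr k n)) /=.
rewrite (big_cat_nat (leq0n m) (ltnW mn)) /= -!/(segsum _ _ _ _).
rewrite addrAC addrK; apply: cposD; exact: ip_cpos (segsum_semi_inner _ _) _.
Qed.

Lemma ell2norm_le (x : ell2) (t : R) : 0 <= t ->
  (forall n, segnorm 0 n x <= t) -> ell2norm x <= t.
Proof.
move=> t0 h; rewrite -(ger0_norm t0) -sqrtr_sqr; apply: ler_wsqrtr.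
apply: (cvg_cnorm_le (cvg_ell2_ip x x) (N := 0)) => n _.
by rewrite -ipnorm_sqr ler_sqr ?nnegrE ?ipnorm_ge0.
Qed.

Lemma coord_le_ell2norm (x : ell2) i : cnorm (x i) <= ell2norm x.
Proof. by rewrite -segnorm1 segnorm_le_ell2norm. Qed.

Lemma ell2_ip_eq0 (x : ell2) : ell2_ip x x = 0 -> x = 0.
Proof.
move=> x0; apply: ell2_eq => i; apply: cnorm_eq0; apply/eqP.
rewrite eq_le cnorm_ge0 andbT; apply: le_trans (coord_le_ell2norm x i) _.
by rewrite /ipnorm x0 cnorm0 sqrtr0.
Qed.

Lemma ell2B_apply (x y : ell2) i : (x - y) i = x i - y i.
Proof. by rewrite /= !fctE scaleN1r. Qed.

Lemma segnorm_cvg0 (u : nat -> nat -> A) x n (d : R) :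
  (forall i, cvg_cnorm (u^~ i) (x i)) -> 0 < d ->
  exists M, forall k, (M <= k)%N -> forall m, segnorm m n (u k - x) < d.
Proof.
move=> ux d0.
have [M hM] : exists M, forall k, (M <= k)%N -> forall m,
    cnorm (segsum m n (u k - x) (u k - x)) < d ^+ 2.
  have : 0 < d ^+ 2 by rewrite exprn_gt0.
  move: (d ^+ 2); elim: n => [|n IH] e e0.
    by exists 0%N => k _ m; rewrite /segsum big_geq // cnorm0.
  have e2 : 0 < e / 2 by lra.
  have [M hM] := IH _ e2.
  (* Below $1$ the square of a norm is at most the norm, so the new term also stays under
     [e / 2]. *)
  have [K hK] : exists K, forall k, (K <= k)%N -> cnorm (u k n - x n) < Num.min 1 (e / 2).
    by apply: (ux n); rewrite lt_min ltr01.
  exists (maxn M K) => k; rewrite geq_max => /andP[/hM {}hM /hK].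
  rewrite lt_min => /andP[h1 h2] m.
  have [mn|nm] := leqP m n; last by rewrite /segsum big_geq // cnorm0.
  rewrite /segsum big_nat_recr //=; apply: le_lt_trans (ler_cnormD _ _) _.
  rewrite cstar_identity; have := hM m; have := cnorm_ge0 (u k n - x n).
  rewrite -/(segsum _ _ _ _) !fctE; nra.
exists M => k /hM h m; rewrite -(ger0_norm (ltW d0)) -sqrtr_sqr.
by rewrite ltr_sqrt ?exprn_gt0.
Qed.

Lemma ell2_complete (u : nat -> ell2) :
  (forall e : R, 0 < e -> exists N : nat, forall i j : nat,
     (N <= i)%N -> (N <= j)%N -> ell2norm (u i - u j) < e) ->
  exists l, forall e : R, 0 < e -> exists N : nat, forall i : nat,
     (N <= i)%N -> ell2norm (u i - l) < e.
Proof.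
move=> cu.
have cx i : exists l, cvg_cnorm (fun k => u k i) l.
  apply: cnorm_complete => e /cu[N hN]; exists N => j k Nj Nk.
  by apply: le_lt_trans (hN j k Nj Nk); rewrite -ell2B_apply; apply: coord_le_ell2norm.
have [l hl] := choice cx.
have segB (x y : ell2) m n :
    segnorm m n (ell2_val (x - y)) = segnorm m n (ell2_val x - ell2_val y).
  by congr (ipnorm _ _); apply: funext => i; rewrite ell2B_apply !fctE.
(* A fixed window has finitely many coordinates, so the Cauchy estimate passes to the coordinatewise
   limit there. As [N] does not depend on the window, this gives both that [l] is square-summable
   and that [u] converges to it. *)
have ul e : 0 < e -> exists N : nat, forall k, (N <= k)%N -> forall m n,
    segnorm m n ((u k : nat -> A) - l) <= e.
  move=> /cu[N hN]; exists N => k Nk m n; apply/ler_addgt0Pr => d d0.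
  have [M hM] := segnorm_cvg0 n hl d0.
  have h1 := hM _ (leq_maxr N M) m; have h2 := hN k _ Nk (leq_maxl N M).
  have P := segsum_semi_inner m n.
  apply: le_trans (ler_ipnorm_dist P (u (maxn N M)) _ _) _; apply: lerD; last exact: ltW.
  apply: le_trans (ltW h2); have := segnorm_le_ell2norm m n (u k - u (maxn N M)).
  by rewrite segB.
have sl : square_summable l.
  move=> e e0; have e2 : 0 < e / 2 by lra.
  have [N hN] := ul _ e2; have [M hM] := ell2P (u N) e2.
  exists M => m /hM {}hM n; have h1 := hM n; have h2 := hN N (leqnn N) m n.
  have P := segsum_semi_inner m n.
  rewrite -(subrK (u N : nat -> A) l) ; apply: le_lt_trans (ler_ipnormD P _ _) _.
  rewrite (ipnorm_distC P); lra.
exists (Ell2 sl) => e e0; have e2 : 0 < e / 2 by lra.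
have [N hN] := ul _ e2; exists N => k Nk; apply: (@le_lt_trans _ _ (e / 2)); last lra.
apply: ell2norm_le => [|n]; first lra.
by rewrite segB; apply: hN.
Qed.

(** Its value at $a=1$ shows that the module is nonzero and that the left action of [A] is
    isometric. *)
Definition single0 a : nat -> A := fun i => if i is 0%N then a else 0.

Lemma single0_summable a : square_summable (single0 a).
Proof.
move=> e e0; exists 1%N => m m1 n; rewrite /ipnorm /segsum big_nat_cond big1 ?cnorm0 ?sqrtr0 //.
by move=> [|i] /andP[/andP[mi _] _]; [move: (leq_trans m1 mi)|rewrite /= mulr0].
Qed.

Definition ell2_single0 a := Ell2 (single0_summable a).

Lemma ell2norm_single0 a : ell2norm (ell2_single0 a) <= cnorm a.
Proof.
apply: ell2norm_le => [|[|n]]; first exact: cnorm_ge0.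
  by rewrite segnorm_nil ?cnorm_ge0.
rewrite /ipnorm /segsum big_nat_recl // big1 => [|i _]; last by rewrite /= mulr0.
by rewrite addr0 /= cstar_identity sqrtr_sqr ger0_norm ?cnorm_ge0.
Qed.

Lemma ell2_neq0 : exists x : ell2, x != 0.
Proof.
exists (ell2_single0 1); apply/eqP => /(congr1 (fun x : ell2 => x 0%N)) /=.
by move/eqP; rewrite oner_eq0.
Qed.

Definition ell2_module : hilbertModule A :=
  HilbertModule ell2_semi_inner ell2_ip_eq0 ell2_complete ell2_neq0.

End SquareSummable.
Arguments segsum_semi_inner {R A}.

(** * The left action and the Cuntz isometries on $l^2(A)$ *)

Lemma big_nat_double (V : nmodType) (F : nat -> V) m n :
  \sum_(m.*2 <= i < n.*2) F i = \sum_(m <= i < n) (F i.*2 + F i.*2.+1).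
Proof.
elim: n => [|n IH]; first by rewrite !big_geq.
have [mn|nm] := leqP m n; last by rewrite !big_geq // leq_double.
rewrite doubleS !big_nat_recr ?leq_double //=; last by rewrite ltnW // ltnS leq_double.
by rewrite IH addrA.
Qed.

Section CuntzOperators.
Variables (R : realType) (A : cstarAlgType R).
Local Notation H := (ell2_module A).
Local Notation B := (adjointable H).
Implicit Types (a : A) (b : bool) (x y : ell2 A).

Definition lact a x : ell2 A :=
  Ell2 (square_summable_lip (fun m n => segnorm_lact m n x a) (ell2P x)).

Lemma lact_adjoint_pair a : adjoint_pair (H := H) (lact a) (lact (star a)).
Proof.
move=> x y; apply: (cvg_cnorm_unique (cvg_ell2_ip (lact a x) y)).
have -> : (fun n => segsum 0 n (lact a x) y) = (fun n => segsum 0 n x (lact (star a) y)).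
  apply: funext => n; apply: eq_bigr => i _.
  by rewrite /= starM mulrA.
exact: cvg_ell2_ip.
Qed.

Lemma ell2norm_lact a x : ipnorm (@ell2_ip R A) (lact a x) <= cnorm a * ipnorm (@ell2_ip R A) x.
Proof.
apply: ell2norm_le => [|n]; first by rewrite mulr_ge0 ?cnorm_ge0 ?ipnorm_ge0.
apply: le_trans (segnorm_lact _ _ _ _) _.
by rewrite ler_wpM2l ?cnorm_ge0 // segnorm_le_ell2norm.
Qed.

Lemma lact_adjointable a : is_adjointable (H := H) (lact a).
Proof.
split; first by exists (lact (star a)); apply: lact_adjoint_pair.
by exists (cnorm a); split; [exact: cnorm_ge0|exact: ell2norm_lact].
Qed.

Definition lact_op a : B := Adjointable (lact_adjointable a).

Lemma lact_op_linear : linear lact_op.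
Proof.
move=> c a a'; apply: adjointable_eq => x; apply: ell2_eq => i /=.
by rewrite !fctE mulrDl -scalerAl.
Qed.

Lemma lact_op_monoid : monoid_morphism lact_op.
Proof.
split=> [|a a']; apply: adjointable_eq => x; apply: ell2_eq => i /=.
  by rewrite mul1r.
by rewrite mulrA.
Qed.

HB.instance Definition _ := GRing.isLinear.Build R[i] A B *:%R lact_op lact_op_linear.
HB.instance Definition _ := GRing.isMonoidMorphism.Build A B lact_op lact_op_monoid.

Lemma lact_op_star a : lact_op (star a) = star (lact_op a).
Proof. by apply/esym/adj_unique/lact_adjoint_pair. Qed.

Lemma cnorm_lact_op a : cnorm (lact_op a) = cnorm a.
Proof.
apply/eqP; rewrite eq_le; apply/andP; split.
  by apply: opnorm_le (cnorm_ge0 a) _; apply: ell2norm_lact.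
have := ler_opnorm (lact_op a) (ell2_single0 1).
have := coord_le_ell2norm (lact a (ell2_single0 1)) 0; rewrite /= mulr1 => h1 h2.
have := ell2norm_single0 (1 : A); rewrite cnorm1 => h3.
apply: le_trans h1 (le_trans h2 _).
by rewrite ler_piMr ?opnorm_ge0.
Qed.

Definition lact_embedding : unital_embedding A B :=
  UnitalEmbedding lact_op_star cnorm_lact_op.

(** It moves the coordinate $n$ to $2n+b$, and [pick_seq] is its adjoint. Doubling the ends of the
    windows makes the identities between the two exact on finite sums, before any limit. *)
Definition spread_seq b (x : nat -> A) : nat -> A :=
  fun n => if odd n == b then x n./2 else 0.
Definition pick_seq b (x : nat -> A) : nat -> A := fun n => x (b + n.*2)%N.

Lemma segsum_spread b m n (x y : nat -> A) :
  segsum m.*2 n.*2 (spread_seq b x) y = segsum m n x (pick_seq b y).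
Proof.
rewrite /segsum big_nat_double; apply: eq_bigr => i _.
rewrite /spread_seq /pick_seq /= odd_double uphalf_double doubleK.
by case: b; rewrite /= star0 mul0r ?add0r ?addr0.
Qed.

Lemma pick_spread b c (x : nat -> A) n :
  pick_seq b (spread_seq c x) n = if b == c then x n else 0.
Proof.
by rewrite /pick_seq /spread_seq oddD odd_double addbF half_bit_double; case: b c => [] [].
Qed.

Lemma spread_pick_sum (x : nat -> A) n :
  spread_seq false (pick_seq false x) n + spread_seq true (pick_seq true x) n = x n.
Proof.
rewrite /spread_seq /pick_seq -[in RHS](odd_double_half n).
by case: (odd n); rewrite /= ?add0r ?addr0.
Qed.

Lemma segnorm_spread b m n x :
  ipnorm (segsum m.*2 n.*2) (spread_seq b x) = ipnorm (segsum m n) x.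
Proof.
rewrite /ipnorm segsum_spread; congr (Num.sqrt (cnorm _)).
by apply: eq_bigr => i _; rewrite pick_spread eqxx.
Qed.

Lemma spread_summable b x : square_summable (spread_seq b x).
Proof.
move=> e /(ell2P x)[N hN]; exists N.*2 => m Nm n.
apply: le_lt_trans (hN N (leqnn N) n); rewrite -(segnorm_spread b).
by apply: segnorm_le => //; rewrite -addnn leq_addr.
Qed.

Lemma segnorm_pick b m n (x : nat -> A) :
  ipnorm (segsum m n) (pick_seq b x) <= ipnorm (segsum m.*2 n.*2) x.
Proof.
have p z := ip_cpos (segsum_semi_inner m n) z.
apply: ler_wsqrtr; apply: cpos_norm_le => //.
have -> : segsum m.*2 n.*2 x x = segsum m n (pick_seq false x) (pick_seq false x)
    + segsum m n (pick_seq true x) (pick_seq true x).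
  rewrite -!segsum_spread -(ipDl (segsum_semi_inner _ _)); congr (segsum _ _ _ _).
  by apply: funext => i; rewrite fctE spread_pick_sum.
by case: b; rewrite ?addrK // addrC addKr.
Qed.

Lemma pick_summable b x : square_summable (pick_seq b x).
Proof.
move=> e /(ell2P x)[N hN]; exists N => m Nm n.
apply: le_lt_trans (segnorm_pick b m n x) (hN m.*2 _ n.*2).
by apply: leq_trans Nm _; rewrite -addnn leq_addr.
Qed.

Definition spread b x := Ell2 (spread_summable b x).
Definition pick b x := Ell2 (pick_summable b x).

Lemma spread_adjoint_pair b : adjoint_pair (H := H) (spread b) (pick b).
Proof.
move=> x y; apply: (cvg_cnorm_unique _ (cvg_ell2_ip x (pick b y))).
move=> e /(cvg_ell2_ip (spread b x) y)[N hN]; exists N => n Nn.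
rewrite -segsum_spread; apply: hN.
by apply: leq_trans Nn _; rewrite -addnn leq_addr.
Qed.

Lemma ell2norm_spread b x : ipnorm (@ell2_ip R A) (spread b x) <= 1 * ipnorm (@ell2_ip R A) x.
Proof.
rewrite mul1r; apply: ell2norm_le => [|n]; first exact: ipnorm_ge0.
apply: (le_trans (y := ipnorm (segsum 0 n) x)); last exact: segnorm_le_ell2norm.
by rewrite -(segnorm_spread b 0 n x); apply: segnorm_le => //; rewrite -addnn leq_addr.
Qed.

Lemma spread_adjointable b : is_adjointable (H := H) (spread b).
Proof.
split; first by exists (pick b); apply: spread_adjoint_pair.
by exists 1; split=> //; apply: ell2norm_spread.
Qed.

Definition cuntz b : B := Adjointable (spread_adjointable b).

(** The adjoint is obtained by choice, so it has to be identified through its uniqueness. *)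
Lemma star_cuntz b x : star (cuntz b) x = pick b x.
Proof.
have h := is_adjointable_adj (@spread_adjoint_pair b) (spread_adjointable b).2.
rewrite -[star _]/(adj _) (@adj_unique _ _ _ (cuntz b) (Adjointable h)) //.
by apply: spread_adjoint_pair.
Qed.

Lemma cnorm_cuntz b : cnorm (cuntz b) <= 1.
Proof. by apply: opnorm_le ler01 _; apply: ell2norm_spread. Qed.

Lemma star_cuntzM b c : star (cuntz b) * cuntz c = if b == c then 1 else 0.
Proof.
apply: adjointable_eq => x; apply: ell2_eq => i.
rewrite -[LHS]/((star (cuntz b) (cuntz c x) : ell2 A) i) star_cuntz.
by rewrite /= pick_spread; case: (b == c).
Qed.

Lemma cuntz_sum : cuntz false * star (cuntz false) + cuntz true * star (cuntz true) = 1.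
Proof.
apply: adjointable_eq => x; apply: ell2_eq => i.
rewrite -[RHS]spread_pick_sum.
rewrite -[LHS]/(spread_seq _ (star (cuntz false) x) i + spread_seq _ (star (cuntz true) x) i).
by rewrite !star_cuntz.
Qed.

Lemma cuntz_lact b a : cuntz b * lact_op a = lact_op a * cuntz b.
Proof.
apply: adjointable_eq => x; apply: ell2_eq => i /=.
by rewrite /spread_seq /=; case: eqP => //; rewrite mulr0.
Qed.

End CuntzOperators.

(** * A norm on matrices over a C*-algebra *)

Section MatrixNorm.
Variables (R : realType) (A : cstarAlgType R).

(* Not the C*-norm of M_n(A), but a complete submultiplicative one. *)
Definition mxnorm m n (M : 'M[A]_(m, n)) : R := \sum_i \sum_j cnorm (M i j).

Lemma mxnorm_ge0 m n (M : 'M[A]_(m, n)) : 0 <= mxnorm M.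
Proof. by apply: sumr_ge0 => i _; apply: sumr_ge0 => j _; apply: cnorm_ge0. Qed.

Lemma cnorm_le_mxnorm m n (M : 'M[A]_(m, n)) i j : cnorm (M i j) <= mxnorm M.
Proof.
rewrite /mxnorm (bigD1 i) //= (bigD1 j) //= -addrA lerDl addr_ge0 //.
  by apply: sumr_ge0 => k _; apply: cnorm_ge0.
by apply: sumr_ge0 => k _; apply: sumr_ge0 => l _; apply: cnorm_ge0.
Qed.

Lemma mxnorm_le_entry m n (M : 'M[A]_(m, n)) (t : R) :
  (forall i j, cnorm (M i j) <= t) -> mxnorm M <= t *+ n *+ m.
Proof.
move=> h; rewrite /mxnorm; apply: le_trans (ler_sum _ (fun i _ => ler_sum _ (fun j _ => h i j))) _.
by rewrite !sumr_const !card_ord.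
Qed.

Lemma mxnormN m n (M : 'M[A]_(m, n)) : mxnorm (- M) = mxnorm M.
Proof. by apply: eq_bigr => i _; apply: eq_bigr => j _; rewrite mxE cnormN. Qed.

Lemma ler_mxnormD m n (M N : 'M[A]_(m, n)) : mxnorm (M + N) <= mxnorm M + mxnorm N.
Proof.
rewrite -big_split; apply: ler_sum => i _; rewrite -big_split; apply: ler_sum => j _.
by rewrite mxE ler_cnormD.
Qed.

Lemma ler_mxnormM m n p (M : 'M[A]_(m, n)) (N : 'M[A]_(n, p)) :
  mxnorm (M *m N) <= mxnorm M * mxnorm N.
Proof.
rewrite mulr_suml; apply: ler_sum => i _.
have h k : cnorm ((M *m N) i k) <= \sum_j cnorm (M i j) * cnorm (N j k).
  rewrite mxE; apply: le_trans (ler_cnorm_sum _ _ _) _.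
  by apply: ler_sum => j _; apply: ler_cnormM.
apply: le_trans (ler_sum _ (fun k _ => h k)) _.
rewrite exchange_big mulr_suml; apply: ler_sum => j _; rewrite -mulr_sumr.
apply: ler_wpM2l; first exact: cnorm_ge0.
rewrite /mxnorm (bigD1 j) //= lerDl.
by apply: sumr_ge0 => k _; apply: sumr_ge0 => l _; apply: cnorm_ge0.
Qed.

Lemma mxnorm_star m n (M : 'M[A]_(m, n)) : mxnorm (mxstar M) = mxnorm M.
Proof.
rewrite /mxnorm exchange_big; apply: eq_bigr => i _; apply: eq_bigr => j _.
by rewrite !mxE cnorm_star.
Qed.

(** The module structure of ['M[A]] has its scalars in [A], so a scalar of [R[i]] acts entry by
    entry. *)
Definition mxhalf m n (M : 'M[A]_(m, n)) : 'M[A]_(m, n) := map_mx (fun a => 2^-1 *# a) M.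

Lemma mxnorm_half m n (M : 'M[A]_(m, n)) : mxnorm (mxhalf M) = 2^-1 * mxnorm M.
Proof.
rewrite /mxnorm mulr_sumr; apply: eq_bigr => i _; rewrite mulr_sumr.
by apply: eq_bigr => j _; rewrite mxE cnormR ger0_norm ?invr_ge0.
Qed.

Lemma mxhalf2 m n (M : 'M[A]_(m, n)) : mxhalf M + mxhalf M = M.
Proof. by apply/matrixP => i j; rewrite !mxE -scalerDr rscale_half. Qed.

Lemma mxhalf_mull m n p (M : 'M[A]_(m, n)) (N : 'M[A]_(n, p)) :
  mxhalf M *m N = mxhalf (M *m N).
Proof.
apply/matrixP => i j; rewrite !mxE scaler_sumr; apply: eq_bigr => k _.
by rewrite mxE scalerAl.
Qed.

Lemma mxhalf_mulr m n p (M : 'M[A]_(m, n)) (N : 'M[A]_(n, p)) :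
  M *m mxhalf N = mxhalf (M *m N).
Proof.
apply/matrixP => i j; rewrite !mxE scaler_sumr; apply: eq_bigr => k _.
by rewrite mxE scalerAr.
Qed.

Lemma mxstar_half m n (M : 'M[A]_(m, n)) : mxstar (mxhalf M) = mxhalf (mxstar M).
Proof. by apply/matrixP => i j; rewrite !mxE starR. Qed.

Lemma mxstarD m n (M N : 'M[A]_(m, n)) : mxstar (M + N) = mxstar M + mxstar N.
Proof. by apply/matrixP => i j; rewrite !mxE starD. Qed.

Lemma mxstarN m n (M : 'M[A]_(m, n)) : mxstar (- M) = - mxstar M.
Proof. by apply/matrixP => i j; rewrite !mxE starN. Qed.

End MatrixNorm.

(** * One step of Newton's iteration *)

Section NewtonStep.
Variables (R : realType) (A : cstarAlgType R).

(* Newton's iteration w (3 - w^* w) / 2 for the polar part of w. *)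
Definition polar_step m n (p : 'M[A]_n) (w : 'M[A]_(m, n)) : 'M[A]_(m, n) :=
  w + w *m mxhalf (p - mxstar w *m w).

(** By this symmetry an estimate for $p-w^*w$ also serves for $q-ww^*$, with $w^*$ in place of $w$
    and $p$, $q$ exchanged. *)
Lemma polar_step_star m n (p : 'M[A]_n) (q : 'M[A]_m) (w : 'M[A]_(m, n)) :
  mxstar p = p -> mxstar q = q -> w *m p = w -> q *m w = w ->
  mxstar (polar_step p w) = polar_step q (mxstar w).
Proof.
move=> ps qs wp qw.
have pw : p *m mxstar w = mxstar w by rewrite -{1}ps -mxstarM wp.
have wq : mxstar w *m q = mxstar w by rewrite -{1}qs -mxstarM qw.
rewrite /polar_step mxstarD mxstarM mxstar_half mxstarD mxstarN mxstarM !mxstarK ps.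
congr (_ + _); rewrite mxhalf_mull mxhalf_mulr; congr mxhalf.
by rewrite mulmxBl mulmxBr mulmxA pw wq.
Qed.

(** In the corner where $p$ is the unit, $w^*w=1-2y$, and this is $1-(1+y)(1-2y)(1+y)=3y^2+2y^3$. *)
Lemma polar_step_residual m n (p : 'M[A]_n) (w : 'M[A]_(m, n)) :
  p *m p = p -> mxstar p = p -> w *m p = w ->
  let y := mxhalf (p - mxstar w *m w) in
  p - mxstar (polar_step p w) *m polar_step p w =
    y *m y + y *m y + y *m y + (y *m y *m y + y *m y *m y).
Proof.
move=> pp ps wp y.
have pw : p *m mxstar w = mxstar w by rewrite -{1}ps -mxstarM wp.
have ys : mxstar y = y by rewrite mxstar_half mxstarD mxstarN mxstarM mxstarK ps.
have yp : y *m p = y by rewrite mxhalf_mull mulmxBl pp -mulmxA wp.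
have py : p *m y = y by rewrite mxhalf_mulr mulmxBr pp mulmxA pw.
have ww : mxstar w *m w = p - (y + y) by rewrite mxhalf2 opprB addrC subrK.
have -> : mxstar (polar_step p w) *m polar_step p w =
    p - (y + y) + (p - (y + y)) *m y + (y *m (p - (y + y)) + y *m (p - (y + y)) *m y).
  rewrite /polar_step -/y mxstarD mxstarM ys mulmxDl 2!mulmxDr -!mulmxA (mulmxA (mxstar w)) ww.
  by [].
rewrite mulmxBl mulmxBr mulmxBl !mulmxDl !mulmxDr !mulmxDl py yp.
set z := y *m y; set t := z *m y.
set a := z + z; set b := t + t.
have -> : p - (y + y) + (y - a) + (y - a + (z - b)) = p - (a + a) + (z - b).
  by rewrite addrA -(addrA (p - _)) [y - a + _]addrACA -opprD addrA subrK.
by rewrite opprD opprB addrA [p + _]addrC subrK opprB [b - z]addrC addrA (addrA a) addrK.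
Qed.

Lemma polar_step_mulr m n (p : 'M[A]_n) (w : 'M[A]_(m, n)) :
  p *m p = p -> w *m p = w -> polar_step p w *m p = polar_step p w.
Proof.
move=> pp wp; rewrite /polar_step mulmxDl wp -mulmxA mxhalf_mull mulmxBl pp.
by rewrite -mulmxA wp.
Qed.

Lemma polar_step_mull m n (p : 'M[A]_n) (q : 'M[A]_m) (w : 'M[A]_(m, n)) :
  q *m w = w -> q *m polar_step p w = polar_step p w.
Proof. by move=> qw; rewrite /polar_step mulmxDr mulmxA qw. Qed.

(** The norm $Y$ of $y$ is half the old residual and at most $1/4$, so $3Y^2+2Y^3\le\frac78Y$. Of
    the quadratic convergence only a geometric rate is kept, which is enough for a Cauchy
    sequence. *)
Lemma mxnorm_polar_residual m n (p : 'M[A]_n) (w : 'M[A]_(m, n)) :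
  p *m p = p -> mxstar p = p -> w *m p = w ->
  mxnorm (p - mxstar w *m w) <= 2^-1 ->
  mxnorm (p - mxstar (polar_step p w) *m polar_step p w) <=
    2^-1 * mxnorm (p - mxstar w *m w).
Proof.
move=> pp ps wp h; rewrite polar_step_residual // -mxnorm_half.
set y := mxhalf _; have : mxnorm y <= 4^-1 by rewrite mxnorm_half; lra.
have y0 := mxnorm_ge0 y; move=> y4.
have := ler_mxnormD (y *m y + y *m y + y *m y) (y *m y *m y + y *m y *m y).
have := ler_mxnormD (y *m y + y *m y) (y *m y).
have := ler_mxnormD (y *m y) (y *m y).
have := ler_mxnormD (y *m y *m y) (y *m y *m y).
have := ler_mxnormM y y; have := ler_mxnormM (y *m y) y.
set Y := mxnorm y in y0 y4 *; move=> h3 h2.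
have h4 : mxnorm (y *m y *m y) <= Y * Y * Y by apply: le_trans h3 _; apply: ler_wpM2r.
have h5 : Y * Y <= 4^-1 * Y by apply: ler_wpM2r.
have h6 : Y * Y * Y <= 4^-1 * (4^-1 * Y) by rewrite -mulrA; apply: ler_pM; rewrite ?mulr_ge0.
lra.
Qed.

End NewtonStep.

(** * Entrywise limits of matrices *)

Section MatrixConvergence.
Variables (R : realType) (A : cstarAlgType R).

Lemma cvg_cnorm_sum I (r : seq I) (u : I -> nat -> A) (l : I -> A) :
  (forall i, cvg_cnorm (u i) (l i)) ->
  cvg_cnorm (fun k => \sum_(i <- r) u i k) (\sum_(i <- r) l i).
Proof.
move=> ul; elim: r => [|i r IH].
  by rewrite big_nil; under eq_fun do rewrite big_nil; apply: cvg_cnorm_cst.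
by rewrite big_cons; under eq_fun do rewrite big_cons; apply: cvg_cnormD.
Qed.

Lemma cvg_cnorm_mulmx r s t (U : nat -> 'M[A]_(r, s)) (V : nat -> 'M[A]_(s, t))
    (L : 'M[A]_(r, s)) (M : 'M[A]_(s, t)) (C : R) :
  (forall k, mxnorm (U k) <= C) ->
  (forall i j, cvg_cnorm (fun k => U k i j) (L i j)) ->
  (forall i j, cvg_cnorm (fun k => V k i j) (M i j)) ->
  forall i j, cvg_cnorm (fun k => (U k *m V k) i j) ((L *m M) i j).
Proof.
move=> UC UL VM i j; rewrite mxE; under eq_fun do rewrite mxE.
apply: cvg_cnorm_sum => l; apply: cvg_cnormM (UL i l) (VM l j) => k.
by apply: le_trans (UC k); apply: cnorm_le_mxnorm.
Qed.

Lemma geom_small (e : R) : 0 < e -> exists K : nat, forall k, (K <= k)%N -> (2^-1 : R) ^+ k.+1 < e.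
Proof.
move=> e0.
have ek : 0 <= e^-1 by rewrite invr_ge0 ltW.
exists (Num.bound e^-1) => k Kk.
have : e^-1 < k.+1%:R by apply: lt_le_trans (archi_boundP ek) _; rewrite ler_nat leqW.
rewrite exprVn => h; rewrite invf_plt ?posrE ?exprn_gt0 //.
by apply: lt_trans h _; rewrite -natrX ltr_nat ltn_expl.
Qed.

Lemma mx_residual_limit s (e : 'M[A]_s) (V : nat -> 'M[A]_s) (L : 'M[A]_s) :
  (forall i j, cvg_cnorm (fun k => V k i j) (L i j)) ->
  (forall k, mxnorm (e - V k) <= 2^-1 ^+ k.+1) -> L = e.
Proof.
move=> VL Ve; apply/matrixP => i j; apply: (cvg_cnorm_unique (VL i j)) => d d0.
have [K hK] := geom_small d0; exists K => k /hK; apply: le_lt_trans; apply: le_trans (Ve k).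
by have := cnorm_le_mxnorm (e - V k) i j; rewrite !mxE cnorm_distC.
Qed.

End MatrixConvergence.

(** * From an approximate to an exact partial isometry *)

Section PolarLimit.
Variables (R : realType) (A : cstarAlgType R) (m n : nat).
Variables (p : 'M[A]_n) (q : 'M[A]_m) (w : 'M[A]_(m, n)).
Hypotheses (pp : p *m p = p) (ps : mxstar p = p) (qq : q *m q = q) (qs : mxstar q = q).
Hypotheses (wp : w *m p = w) (qw : q *m w = w).
Hypotheses (wp2 : mxnorm (p - mxstar w *m w) <= 2^-1).
Hypotheses (wq2 : mxnorm (q - w *m mxstar w) <= 2^-1).

Let W k := iter k (polar_step p) w.
Local Notation g k := ((2^-1 : R) ^+ k).

Lemma polar_iterP k : [/\ W k *m p = W k, q *m W k = W k,
  mxnorm (p - mxstar (W k) *m W k) <= g k.+1 &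
  mxnorm (q - W k *m mxstar (W k)) <= g k.+1].
Proof.
elim: k => [|k [h1 h2 h3 h4]]; first by split; rewrite ?expr1.
have g1 : g k.+1 <= 2^-1 by rewrite exprS ler_piMr // exprn_ile1 // invf_le1 // ler1n.
split; first exact: polar_step_mulr.
- exact: polar_step_mull.
- rewrite (exprS _ k.+1); apply: le_trans (mxnorm_polar_residual pp ps h1 (le_trans h3 g1)) _.
  exact: ler_wpM2l.
- have h1' : mxstar (W k) *m q = mxstar (W k) by rewrite -{1}qs -mxstarM h2.
  have E : mxstar (W k.+1) = polar_step q (mxstar (W k)) by apply: polar_step_star.
  rewrite -[W k.+1](mxstarK) E mxstarK.
  have h4' : mxnorm (q - mxstar (mxstar (W k)) *m mxstar (W k)) <= g k.+1 by rewrite mxstarK.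
  rewrite (exprS _ k.+1); apply: le_trans (mxnorm_polar_residual qq qs h1' (le_trans h4' g1)) _.
  exact: ler_wpM2l.
Qed.

Lemma mxnorm_polar_iterS k : mxnorm (W k.+1 - W k) <= mxnorm (W k) * g k.+2.
Proof.
have [_ _ h _] := polar_iterP k.
rewrite [W k.+1]/(polar_step p (W k)) /polar_step addrC addKr.
apply: le_trans (ler_mxnormM _ _) _; apply: ler_wpM2l; first exact: mxnorm_ge0.
by rewrite mxnorm_half (exprS _ k.+1) ler_wpM2l.
Qed.

(** The factor $2-2^{-k}$ closes the induction: as $\|W_k\|\le2\|w\|$, the increment is at most
    $2\|w\|2^{-k-2}=\|w\|(2^{-k}-2^{-k-1})$. *)
Lemma mxnorm_polar_iter k : mxnorm (W k) <= mxnorm w * (2 - g k).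
Proof.
elim: k => [|k IH]; first by rewrite expr0 (_ : 2 - 1 = 1 :> R) ?mulr1 //; lra.
have w0 := mxnorm_ge0 w; have g0 : 0 <= g k by rewrite exprn_ge0.
have := ler_mxnormD (W k.+1 - W k) (W k); rewrite subrK.
have := mxnorm_polar_iterS k; rewrite (exprS _ k.+1) (exprS _ k) => h1 h2.
have : mxnorm (W k) * g k <= mxnorm w * 2 * g k.
  by apply: ler_wpM2r => //; apply: le_trans IH _; apply: ler_wpM2l => //; lra.
lra.
Qed.

(** The bound is the increment of $-\|w\|2^{-k}$, an increasing sequence bounded by $0$, as
    [cvg_cnorm_dominated] requires. *)
Lemma mxnorm_polar_dist k :
  mxnorm (W k.+1 - W k) <= (- mxnorm w * g k.+1) - (- mxnorm w * g k).
Proof.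
have w0 := mxnorm_ge0 w; have g0 : 0 <= g k by rewrite exprn_ge0.
have := mxnorm_polar_iterS k; rewrite (exprS _ k.+1) (exprS _ k) => h1.
have : mxnorm (W k) * g k <= mxnorm w * 2 * g k.
  apply: ler_wpM2r => //; apply: le_trans (mxnorm_polar_iter k) _.
  by apply: ler_wpM2l => //; lra.
lra.
Qed.

Lemma polar_partial_isometry :
  exists u : 'M[A]_(m, n), mxstar u *m u = p /\ u *m mxstar u = q.
Proof.
have cW ij : exists l, cvg_cnorm (fun k => W k ij.1 ij.2) l.
  case: ij => i j /=.
  apply: (@cvg_cnorm_dominated _ _ _ (fun k => - mxnorm w * g k) 0) => k.
    by rewrite mulNr oppr_le0 mulr_ge0 ?mxnorm_ge0 ?exprn_ge0.
  apply: le_trans (mxnorm_polar_dist k).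
  by have := cnorm_le_mxnorm (W k.+1 - W k) i j; rewrite !mxE.
have [l hl] := choice cW.
pose u : 'M[A]_(m, n) := \matrix_(i, j) l (i, j).
have Wu i j : cvg_cnorm (fun k => W k i j) (u i j) by rewrite mxE; apply: (hl (i, j)).
have Wus i j : cvg_cnorm (fun k => mxstar (W k) i j) (mxstar u i j).
  by rewrite !mxE; under eq_fun do rewrite !mxE; apply: cvg_cnorm_star (hl (j, i)).
have Wb k : mxnorm (W k) <= mxnorm w * 2.
  apply: le_trans (mxnorm_polar_iter k) _; apply: ler_wpM2l; first exact: mxnorm_ge0.
  by rewrite gerBl exprn_ge0.
have Wsb k : mxnorm (mxstar (W k)) <= mxnorm w * 2 by rewrite mxnorm_star.
exists u; split.
  apply: (mx_residual_limit (cvg_cnorm_mulmx Wsb Wus Wu)) => k.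
  by have [_ _ ] := polar_iterP k.
apply: (mx_residual_limit (cvg_cnorm_mulmx Wb Wu Wus)) => k.
by have [_ _ _] := polar_iterP k.
Qed.

End PolarLimit.

(** * Approximate Cuntz isometries in an existentially closed algebra *)

Section ExistentialClosedness.
Variables (R : realType).

(* The formula is the sum of the norms of the terms. *)
Lemma existentially_closed_in_solve (A B : cstarAlgType R) (iota : unital_embedding A B)
    (p q : nat) (I : finType) (t : I -> starpoly R (p + q))
    (a : p.-tuple A) (c : q.-tuple B) (e : R) :
  existentially_closed_in iota -> 0 < e ->
  (forall i, cnorm (tnth c i) <= 1) ->
  (forall i, sp_eval (cat_tuple (map_tuple iota a) c) (t i) = 0) ->
  exists b : q.-tuple A, (forall i, cnorm (tnth b i) <= 1) /\
    forall i, cnorm (sp_eval (cat_tuple a b) (t i)) < e.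
Proof.
move=> iotaP e0 c1 tc.
have f_cont : continuous (fun v : 'rV[R]_#|I| => \sum_j v 0 j).
  by apply: continuous_big => [x|j _ x]; [exact: add_continuous|exact: coord_continuous].
pose phi := QFFormula f_cont (fun j => t (enum_val j)).
have := iotaP p q phi 1%N a (leqnn 1) => /esym infE.
have : (ereal_inf [set (qf_eval phi (cat_tuple a b))%:E | b in tuple_ball A q 1] < e%:E)%E.
  rewrite -infE; apply/ereal_inf_ltP; exists 0%E; last by rewrite lte_fin.
  exists c => //; congr (_%:E); rewrite /qf_eval /=; apply: big1 => j _.
  by rewrite mxE tc cnorm0.
move=> /ereal_inf_ltP[_ [b b1 <-]]; rewrite lte_fin => be; exists b; split=> // i.
apply: le_lt_trans be; rewrite /qf_eval /= (bigD1 (enum_rank i)) //= mxE enum_rankK lerDl.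
by apply: sumr_ge0 => j _; rewrite mxE cnorm_ge0.
Qed.

(** A formula has finitely many parameters, so commutation is asked only with the entries of one
    matrix. These are the parameters, flattened by [mxvec]; the two isometries are the unknowns. *)
Lemma approx_central_cuntz (A : cstarAlgType R) (n : nat) (M : 'M[A]_n) (e : R) :
  existentially_closed A -> 0 < e ->
  exists s : bool -> A, [/\ forall b, cnorm (s b) <= 1,
    forall b c, cnorm (star (s b) * s c - (b == c)%:R) < e,
    cnorm (s false * star (s false) + s true * star (s true) - 1) < e &
    forall b i j, cnorm (s b * M i j - M i j * s b) < e].
Proof.
move=> hA e0.
pose o (b : bool) : 'I_2 := if b then ord_max else ord0.
pose S b : starpoly R (n * n + 2) := SPvar R (rshift (n * n) (o b)).
pose X i j : starpoly R (n * n + 2) := SPvar R (lshift 2 (mxvec_index i j)).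
pose opp t : starpoly R (n * n + 2) := SPmul (SPconst _ (-1)) t.
pose t (k : (bool * bool) + unit + (bool * ('I_n * 'I_n))) := match k with
  | inl (inl bc) => SPadd (SPmul (SPstar (S bc.1)) (S bc.2)) (opp (SPconst _ (bc.1 == bc.2)%:R))
  | inl (inr _) => SPadd (SPadd (SPmul (S false) (SPstar (S false)))
                                (SPmul (S true) (SPstar (S true)))) (opp (SPconst _ 1))
  | inr bij => SPadd (SPmul (S bij.1) (X bij.2.1 bij.2.2))
                     (opp (SPmul (X bij.2.1 bij.2.2) (S bij.1)))
  end.
pose a := [tuple mxvec M 0 k | k < n * n].
pose c := [tuple of [:: cuntz A false; cuntz A true]].
have oE (T : Type) (u v : T) b : tnth [tuple of [:: u; v]] (o b) = if b then v else u by case: b.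
have aE i j : tnth a (mxvec_index i j) = M i j by rewrite tnth_mktuple mxvecE.
have oppE (C : cstarAlgType R) (x : (n * n + 2).-tuple C) u :
    sp_eval x (opp u) = - sp_eval x u by rewrite /= scaleN1r mulN1r.
have SB b : tnth (cat_tuple (map_tuple (lact_embedding A) a) c) (rshift (n * n) (o b)) = cuntz A b.
  by rewrite tnth_rshift oE; case: b.
have XB i j : tnth (cat_tuple (map_tuple (lact_embedding A) a) c) (lshift 2 (mxvec_index i j))
    = lact_op (M i j) by rewrite tnth_lshift tnth_map aE.
have [||b [b1 bt]] := existentially_closed_in_solve (t := t) (a := a) (c := c)
    (@hA _ (lact_embedding A)) e0.
- by move=> [[|[|i]] hi] //; rewrite (tnth_nth 0); apply: cnorm_cuntz.
- move=> [[[b b']|[]]|[b [i j]]]; rewrite /t /S /X; cbn [sp_eval]; rewrite oppE; cbn [sp_eval fst snd].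
  + by rewrite !SB star_cuntzM; case: eqP => _; rewrite ?scale1r ?scale0r subrr.
  + by rewrite !SB cuntz_sum scale1r subrr.
  + by rewrite !SB !XB cuntz_lact subrr.
have SA b' : tnth (cat_tuple a b) (rshift (n * n) (o b')) = tnth b (o b') by rewrite tnth_rshift.
have XA i j : tnth (cat_tuple a b) (lshift 2 (mxvec_index i j)) = M i j by rewrite tnth_lshift aE.
exists (fun b' => tnth b (o b')); split=> [b'|b' c'||b' i j].
- exact: b1.
- have := bt (inl (inl (b', c'))); rewrite /t /S /X; cbn [sp_eval]; rewrite oppE.
  by cbn [sp_eval fst snd]; rewrite !SA scaler_nat.
- have := bt (inl (inr tt)); rewrite /t /S /X; cbn [sp_eval]; rewrite oppE.
  by cbn [sp_eval fst snd]; rewrite !SA scale1r.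
- have := bt (inr (b', (i, j))); rewrite /t /S /X; cbn [sp_eval]; rewrite oppE.
  by cbn [sp_eval fst snd]; rewrite !SA !XA.
Qed.

End ExistentialClosedness.

(** * The equivalence of a projection with its double *)

Section ProjectionDoubling.
Variables (R : realType) (A : cstarAlgType R).

Lemma mxnorm_scalar n (a : A) : mxnorm (a%:M : 'M[A]_n) <= cnorm a *+ n *+ n.
Proof.
apply: mxnorm_le_entry => i j; rewrite mxE; case: (i == j); rewrite ?lexx //.
by rewrite mulr0n cnorm0 cnorm_ge0.
Qed.

Lemma mxstar_scalar n (a : A) : mxstar (a%:M : 'M[A]_n) = (star a)%:M.
Proof.
by apply/matrixP => i j; rewrite !mxE eq_sym; case: (i == j); rewrite ?mulr1n // star0.
Qed.

Lemma scalar_mxMM n (a b : A) : (a%:M : 'M[A]_n) *m b%:M = (a * b)%:M.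
Proof. by rewrite -scalar_mxM. Qed.

Lemma mxnorm_block m1 m2 n1 n2 (M : 'M[A]_(m1, n1)) (N : 'M[A]_(m1, n2))
    (P : 'M[A]_(m2, n1)) (Q : 'M[A]_(m2, n2)) :
  mxnorm (block_mx M N P Q) = mxnorm M + mxnorm N + (mxnorm P + mxnorm Q).
Proof.
rewrite /mxnorm big_split_ord -!big_split /=; congr (_ + _); apply: eq_bigr => i _;
  rewrite big_split_ord; congr (_ + _); apply: eq_bigr => j _.
- by rewrite block_mxEul.
- by rewrite block_mxEur.
- by rewrite block_mxEdl.
- by rewrite block_mxEdr.
Qed.

Lemma mxstar_col m1 m2 n (M : 'M[A]_(m1, n)) (N : 'M[A]_(m2, n)) :
  mxstar (col_mx M N) = row_mx (mxstar M) (mxstar N).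
Proof. by rewrite /mxstar map_col_mx tr_col_mx. Qed.

Lemma mxnorm3 m n k l (M : 'M[A]_(m, n)) (N : 'M[A]_(n, k)) (P : 'M[A]_(k, l)) (x y z : R) :
  mxnorm M <= x -> mxnorm N <= y -> mxnorm P <= z -> mxnorm (M *m N *m P) <= x * y * z.
Proof.
move=> hx hy hz; apply: le_trans (ler_mxnormM _ _) _; apply: ler_pM; rewrite ?mxnorm_ge0 //.
by apply: le_trans (ler_mxnormM _ _) _; apply: ler_pM; rewrite ?mxnorm_ge0.
Qed.

(* With exact Cuntz isometries s_b commuting with p, the column of the
   s_b^* p conjugates p into p (+) p; the approximate column is corrected
   by polar_partial_isometry. *)
Lemma projection_double n (p : 'M[A]_n) : existentially_closed A ->
  p *m p = p -> mxstar p = p ->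
  exists u : 'M[A]_(n + n, n), mxstar u *m u = p /\ u *m mxstar u = dsum_mx p p.
Proof.
move=> hA pp ps.
(* [T] is $n^2$, a bound for scalar matrices with entry of norm at most $1$. Each block of $p\oplus
   p-ww^*$ will be bounded by $K(eT)K+K(T\cdot eT)K=Le$. *)
pose K := mxnorm p; pose T : R := 1 *+ n *+ n; pose L := K * K * T * (1 + T).
have K0 : 0 <= K by apply: mxnorm_ge0.
have T0 : 0 <= T by rewrite !mulrn_wge0.
have L0 : 0 <= L by rewrite !mulr_ge0 // addr_ge0.
(* With $Le\le1/8$ the four blocks of $p\oplus p-ww^*$ sum to at most $1/2$; the residual $p-w^*w$
   is at most $2Le$. *)
pose e := (8 * (L + 1))^-1; have e0 : 0 < e by rewrite invr_gt0 mulr_gt0 // ltr_wpDl.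
have Le : L * e <= 8^-1.
  by rewrite /e ler_pdivrMr ?mulr_gt0 ?ltr_wpDl // mulKf // lerDl.
have [s [s1 sM sD sC]] := approx_central_cuntz p hA e0.
have nT (x : R) : x *+ n *+ n = x * T by rewrite /T !mulrnAr mulr1.
pose D b : 'M[A]_n := (s b)%:M; pose Ds b : 'M[A]_n := (star (s b))%:M.
have DsE b : mxstar (D b) = Ds b by apply: mxstar_scalar.
have DsK b : mxstar (Ds b) = D b by rewrite mxstar_scalar starK.
have Ds1 b : mxnorm (Ds b) <= T.
  apply: le_trans (mxnorm_scalar _ _) _; rewrite nT cnorm_star.
  by rewrite ler_piMl.
(* [E], [F] and [G] are the defects of commutation with $p$, of the sum of the range projections and
   of the relations $s_b^*s_c=\delta_{bc}$. *)
pose E b := D b *m p - p *m D b.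
have Ee b : mxnorm (E b) <= e * T.
  rewrite -nT; apply: mxnorm_le_entry => i j.
  rewrite !mxE (bigD1 i) //= big1 ?addr0 => [|k ki]; last first.
    by rewrite !mxE eq_sym (negPf ki) mulr0n mul0r.
  rewrite (bigD1 j) //= big1 ?addr0 => [|k kj]; last by rewrite !mxE (negPf kj) mulr0n mulr0.
  by rewrite !mxE !eqxx !mulr1n ltW.
pose F := D false *m Ds false + D true *m Ds true - 1%:M.
have Fe : mxnorm F <= e * T.
  rewrite /F !scalar_mxMM -raddfD -raddfB; apply: le_trans (mxnorm_scalar _ _) _.
  by rewrite nT ler_wpM2r // ltW.
pose G b c := Ds b *m D c - ((b == c)%:R)%:M.
have Ge b c : mxnorm (G b c) <= e * T.
  rewrite /G !scalar_mxMM -raddfB; apply: le_trans (mxnorm_scalar _ _) _.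
  by rewrite nT ler_wpM2r // ltW.
(* For exactly commuting isometries this is $s_b^*p$. Compressing from both sides makes $Wp=W$ and
   $pW=W$ exact, as Newton's iteration assumes. *)
pose W b := p *m Ds b *m p.
have WsE b : mxstar (W b) = p *m D b *m p by rewrite !mxstarM DsK ps mulmxA.
have Wp b : W b *m p = W b by rewrite /W -mulmxA pp.
have pW b : p *m W b = W b by rewrite /W !mulmxA pp.
have WsW b : mxstar (W b) *m W b = p *m (E b *m Ds b) *m p + p *m (D b *m Ds b) *m p.
  rewrite WsE /W.
  have -> : p *m D b *m p *m (p *m Ds b *m p) = p *m (D b *m p *m Ds b) *m p.
    by rewrite !mulmxA -(mulmxA _ p p) pp.
  have -> : D b *m p = E b + p *m D b by rewrite subrK.
  by rewrite mulmxDl mulmxDr mulmxDl !mulmxA pp.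
have WWs b c : W b *m mxstar (W c) =
    p *m G b c *m p - p *m (Ds b *m E c) *m p + (if b == c then p else 0).
  rewrite WsE /W.
  have -> : p *m Ds b *m p *m (p *m D c *m p) = p *m (Ds b *m (p *m D c)) *m p.
    by rewrite !mulmxA -(mulmxA _ p p) pp.
  have -> : p *m D c = D c *m p - E c by rewrite /E opprB addrC subrK.
  have -> : (if b == c then p else 0) = p *m ((b == c)%:R)%:M *m p.
    by case: (b == c); rewrite ?mulmx1 ?pp // mulr0n raddf0 mulmx0 mul0mx.
  rewrite [RHS]addrAC -mulmxDl -mulmxDr /G subrK mulmxBr mulmxBr mulmxBl; congr (_ - _).
  by rewrite -!mulmxA pp.
have WWse b c : mxnorm ((if b == c then p else 0) - W b *m mxstar (W c)) <= L * e.
  rewrite WWs [X in _ - X]addrC opprD addrA subrr sub0r mxnormN.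
  apply: le_trans (ler_mxnormD _ _) _; rewrite mxnormN.
  have h1 : mxnorm (p *m G b c *m p) <= K * (e * T) * K by apply: mxnorm3.
  have h2 : mxnorm (p *m (Ds b *m E c) *m p) <= K * (T * (e * T)) * K.
    apply: mxnorm3 => //; apply: le_trans (ler_mxnormM _ _) _.
    by apply: ler_pM; rewrite ?mxnorm_ge0.
  by apply: le_trans (lerD h1 h2) _; rewrite /L; lra.
pose w := col_mx (W false) (W true).
have wsE : mxstar w = row_mx (mxstar (W false)) (mxstar (W true)) by apply: mxstar_col.
have wsw : p - mxstar w *m w =
    - (p *m (E false *m Ds false) *m p + p *m (E true *m Ds true) *m p + p *m F *m p).
  rewrite wsE mul_row_col !WsW addrACA -(mulmxDl (p *m (D _ *m _))) -mulmxDr.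
  have -> : D false *m Ds false + D true *m Ds true = F + 1%:M by rewrite /F subrK.
  by rewrite mulmxDr mulmxDl mulmx1 pp addrA [X in _ - X]addrC opprD addrA subrr sub0r.
have EDe b : mxnorm (p *m (E b *m Ds b) *m p) <= K * (e * T * T) * K.
  apply: mxnorm3 => //; apply: le_trans (ler_mxnormM _ _) _.
  by apply: ler_pM; rewrite ?mxnorm_ge0.
apply: (@polar_partial_isometry _ _ _ _ p (dsum_mx p p) w) => //.
- by rewrite mulmx_block !(mul0mx, mulmx0, addr0, add0r) pp.
- by rewrite mxstar_block !mxstar0 ps.
- by rewrite mul_col_mx !Wp.
- by rewrite mul_block_col !mul0mx addr0 add0r !pW.
- rewrite wsw mxnormN.
  have h1 : mxnorm (p *m F *m p) <= K * (e * T) * K by apply: mxnorm3.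
  apply: le_trans (ler_mxnormD _ _) _.
  apply: le_trans (lerD (ler_mxnormD _ _) h1) _.
  have := EDe false; have := EDe true.
  have : 0 <= K * (e * T) * K by rewrite !mulr_ge0 // ltW.
  move: Le; rewrite /L; lra.
- rewrite wsE mul_col_row /dsum_mx opp_block_mx add_block_mx mxnorm_block.
  have := WWse false false; have := WWse false true.
  have := WWse true false; have := WWse true true; rewrite !eqxx /=; lra.
Qed.

End ProjectionDoubling.

Theorem proposition2p20 (R : realType) (A : cstarAlgType R)
    (hA : existentially_closed A) :
  [set: K0 A] = [set 0].
Proof.
have dbl (x : prclass A) : x + x = x.
  elim/quotW: x => p; rewrite -[LHS]/(prclass_add _ _) -pi_prclass_add.
  by apply/esym/prclassP; apply: projection_double hA (pr_idem p) (pr_star p).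
apply/seteqP; split=> // x _; rewrite /set1 /=.
(* Adding $x+y$ absorbs both components: $x+(x+y)=x+y=y+(x+y)$, so the formal difference of $x$ and
   $y$ is zero. *)
elim/quotW: x => -[x y]; apply/groth_piP; exists (x + y) => /=.
by rewrite addr0 add0r addrA dbl addrCA dbl.
Qed.
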